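(* Let $(A,G,\alpha)$ be a $C^*$-dynamical system with $G$ a (countable) discrete group and $A$ a unital separable $C^*$-algebra. The following are equivalent: (i) $G$ is weakly amenable, and $A$ has the completely bounded approximation property implemented by a net of maps $\phi_i:A\to A$ which satisfy $\phi_i\circ\alpha_t=\alpha_t\circ\phi_i$ for all $t\in G$ and all $i$; (ii) $(A,G,\alpha)$ is weakly amenable, implemented by a net of Herz--Schur $(A,G,\alpha)$-multipliers $F_i:G\to\mathcal{CB}(A)$ which satisfy $F_i(t)(\alpha_r(a))=\alpha_r(F_i(t)(a))$ for all $r,t\in G$, $a\in A$ and all $i$.
   Context: A $C^*$-dynamical system $(A,G,\alpha)$ with $G$ discrete consists of a $C^*$-algebra $A$, the group $G$, and a group homomorphism $\alpha:G\to\mathrm{Aut}(A)$. Reduced crossed product: fix a faithful representation of $A$ on a separable Hilbert space $\mathcal H$ (regard $A\subseteq\mathcal B(\mathcal H)$). On $\ell^2(G,\mathcal H)$ define $(\pi(a)\xi)(s)=\alpha_{s^{-1}}(a)(\xi(s))$ and $(\lambda_t\xi)(s)=\xi(t^{-1}s)$ for $a\in A$, $s,t\in G$. For $f\in\ell^1(G,A)$ put $(\pi\rtimes\lambda)(f)=\sum_{s\in G}\pi(f(s))\lambda_s$. The reduced crossed product $A\rtimes_{\alpha,r}G$ is the operator-norm closure of $(\pi\rtimes\lambda)(\ell^1(G,A))$; up to isomorphism it does not depend on the faithful representation. $\mathcal{CB}(A)$ denotes the space of completely bounded linear maps $A\to A$. A bounded function $F:G\to\mathcal{CB}(A)$ is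 a Herz--Schur $(A,G,\alpha)$-multiplier if the map $S_F:(\pi\rtimes\lambda)(f)\mapsto(\pi\rtimes\lambda)(F\cdot f)$, where $(F\cdot f)(s)=F(s)(f(s))$ and $f\in\ell^1(G,A)$, is completely bounded on $(\pi\rtimes\lambda)(\ell^1(G,A))$; it then extends uniquely to a completely bounded map on $A\rtimes_{\alpha,r}G$, and $\|F\|_{\mathrm{HS}}:=\|S_F\|_{\mathrm{cb}}$. $(A,G,\alpha)$ is weakly amenable if there is a net $(F_i)$ of finitely supported Herz--Schur $(A,G,\alpha)$-multipliers such that $F_i(t)$ is a finite rank completely bounded map on $A$ for every $t\in G$, $\|F_i(t)(a)-a\|\to0$ for all $t\in G$, $a\in A$, and $\sup_i\|F_i\|_{\mathrm{HS}}<\infty$; such a net is said to implement weak amenability of $(A,G,\alpha)$. A discrete group $G$ is weakly amenable if there is a net of finitely supported Herz--Schur multipliers $v_\gamma:G\to\mathbb C$ (completely bounded multipliers of the Fourier algebra of $G$), uniformly bounded in the Herz--Schur (completely bounded multiplier) norm, converging pointwise to $1$. A net $(\phi_i)$ of maps on $A$ implements the completely bounded approximation property of $A$ if each $\phi_i$ is finite rank and completely bounded, $\phi_i\to\mathrm{id}_A$ in the point-norm topology, and $\sup_i\|\phi_i\|_{\mathrm{cb}}<\infty$. *)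

(* Defs.v *)
From HB Require Import structures.
From mathcomp Require Import all_boot all_order all_algebra finmap.
From mathcomp Require Import all_classical all_reals all_analysis.
From mathcomp Require Import complex sesquilinear.
From mathcomp.analysis.showcase Require summability.

Set Implicit Arguments.
Unset Strict Implicit.
Unset Printing Implicit Defensive.

Import Order.TTheory GRing.Theory Num.Theory.
Import numFieldNormedType.Exports.

Local Open Scope classical_set_scope.
Local Open Scope ring_scope.

(* The norm of a normed space over R[i] is R[i]-valued; rnorm is the same norm
   as an element of R. *)
Definition rnorm (R : realType) (V : normedZmodType R[i]) (x : V) : R :=
  complex.Re `|x|.

(* The inner product is linear in the first variable. *)
HB.mixin Record isHilbert (R : realType) H & CompleteNormedModule R[i] H := {
  inner : {dot H for (@Num.conj R[i])};
  normr_inner : forall x : H, `|x| ^+ 2 = inner x x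
}.

#[short(type="hilbertType")]
HB.structure Definition Hilbert (R : realType) :=
  {H of isHilbert R H & CompleteNormedModule R[i] H}.

(* Unital C*-algebras; 1 != 0 is part of algType.  The norm is R-valued and is
   not declared as a normedZmodType: the library has no join of ring and normed
   structures below Num.NumDomain. *)
HB.mixin Record isCStarAlgebra (R : realType) A & GRing.Algebra R[i] A := {
  cnorm : A -> R;
  star : A -> A;
  cnorm_eq0 : forall x : A, cnorm x = 0 -> x = 0;
  ler_cnormD : forall x y : A, cnorm (x + y) <= cnorm x + cnorm y;
  cnormZ : forall (c : R[i]) (x : A), cnorm (c *: x) = rnorm c * cnorm x;
  ler_cnormM : forall x y : A, cnorm (x * y) <= cnorm x * cnorm y;
  cnorm_complete : forall u : nat -> A,
    (forall e : R, 0 < e -> exists N, forall m n, (N <= m)%N -> (N <= n)%N ->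
       cnorm (u m - u n) < e) ->
    exists l : A, (fun n => cnorm (u n - l)) @ \oo --> (0 : R);
  starK : involutive star;
  starD : forall x y : A, star (x + y) = star x + star y;
  starZ : forall (c : R[i]) (x : A), star (c *: x) = Num.conj c *: star x;
  starM : forall x y : A, star (x * y) = star y * star x;
  cstar_identity : forall x : A, cnorm (star x * x) = cnorm x ^+ 2
}.

#[short(type="cstarAlgType")]
HB.structure Definition CStarAlgebra (R : realType) :=
  {A of isCStarAlgebra R A & GRing.Algebra R[i] A}.

Definition separable_cstar (R : realType) (A : cstarAlgType R) : Prop :=
  exists D : set A, countable D /\
    forall (a : A) (e : R), 0 < e -> exists2 d, D d & cnorm (a - d) < e.

(* Faithful (not necessarily nondegenerate) *-representations on H. *)
Record is_faithful_rep (R : realType) (A : cstarAlgType R) (H : hilbertType R)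
    (rho : A -> H -> H) : Prop := {
  rep_linear : forall (a : A) (c : R[i]) (x y : H),
    rho a (c *: x + y) = c *: rho a x + rho a y;
  rep_bounded : forall a : A, exists M : R,
    forall x : H, rnorm (rho a x) <= M * rnorm x;
  repDZ : forall (c : R[i]) (a b : A) (x : H),
    rho (c *: a + b) x = c *: rho a x + rho b x;
  repM : forall (a b : A) (x : H), rho (a * b) x = rho a (rho b x);
  rep_star : forall (a : A) (x y : H),
    inner (rho (star a) x) y = inner x (rho a y);
  rep_inj : forall a b : A, (forall x : H, rho a x = rho b x) -> a = b
}.

Record is_action (R : realType) (A : cstarAlgType R) (G : groupType)
    (alpha : G -> {lrmorphism A -> A}) : Prop := {
  action_star : forall (t : G) (a : A), alpha t (star a) = star (alpha t a);
  action_bij : forall t : G, bijective (alpha t);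
  actionM : forall (s t : G) (a : A),
    alpha (s * t)%g a = alpha s (alpha t a)
}.

Record directed (I : Type) (le : I -> I -> Prop) : Prop := {
  directed_inhabited : inhabited I;
  directed_refl : forall i, le i i;
  directed_trans : forall j i k, le i j -> le j k -> le i k;
  directed_ub : forall i j, exists2 k, le i k & le j k
}.

(* Convergence of a net (x_i) to l is x @ tails le --> l. *)
Definition tails (I : Type) (le : I -> I -> Prop) : set_system I :=
  [set P | exists i0, forall i, le i0 i -> P i].

Section operator_norms.
Variable R : realType.

Definition enorm (V : normedZmodType R[i]) (x : V) : \bar R := (rnorm x)%:E.

(* Operators on l^2(I, V) are encoded as maps on all functions I -> V; l2norm
   is infinite outside l^2(I, V), and only the values of such a map on
   l^2(I, V) are ever used. *)
Definition l2norm (I : choiceType) (V : normedZmodType R[i]) (xi : I -> V)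
    : \bar R :=
  ((\esum_(i in [set: I]) ((rnorm (xi i)) ^+ 2)%:E) `^ 2^-1)%E.

Definition l2 (I : choiceType) (V : normedZmodType R[i]) : set (I -> V) :=
  [set xi | (l2norm xi < +oo)%E].

Definition l1 (A : cstarAlgType R) (I : choiceType) : set (I -> A) :=
  [set f | (\esum_(i in [set: I]) (cnorm (f i))%:E < +oo)%E].

(* Hilbert direct sum of the (extended) norm N. *)
Definition dsumnorm (K : Type) (N : K -> \bar R) (J : finType) (x : J -> K)
    : \bar R :=
  ((\sum_(j : J) (N (x j)) ^+ 2) `^ 2^-1)%E.

(* Norm of the matrix of operators [T i j] acting on the J-fold direct sum. *)
Definition mxopnorm (K : zmodType) (N : K -> \bar R) (J : finType)
    (T : J -> J -> K -> K) : \bar R :=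
  ereal_sup [set dsumnorm N (fun i => \sum_(j : J) T i j (x j))
            | x in [set x : J -> K | (dsumnorm N x <= 1)%E]].

(* Completely bounded norm of T on D, where NX n and NY n are the norms of
   n x n matrices over the domain and the codomain. *)
Definition cb_norm (X Y : Type) (D : set X)
    (NX : forall n, 'M[X]_n -> \bar R) (NY : forall n, 'M[Y]_n -> \bar R)
    (T : X -> Y) : \bar R :=
  ereal_sup [set y | exists n (a : 'M[X]_n),
    [/\ forall i j, D (a i j), (NX n a <= 1)%E & y = NY n (map_mx T a)]].

Definition l2_mxnorm (I : choiceType) (V : normedZmodType R[i]) n
    (T : 'M[(I -> V) -> (I -> V)]_n) : \bar R :=
  mxopnorm (@l2norm I V) (fun i j => T i j).

End operator_norms.

Section fourier_algebra.
Variables (R : realType) (G : groupType).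
Local Notation C := R[i].

Definition translation (V : Type) (t : G) (xi : G -> V) : G -> V :=
  fun s => xi (t^-1 * s)%g.

Definition l2inner (xi eta : G -> C) : C :=
  summability.sum (fun s => (xi s * Num.conj (eta s) : C^o)).

Definition coefficient (xi eta : G -> C) : G -> C :=
  fun s => l2inner (translation s xi) eta.

Definition fourier_algebra : set (G -> C) :=
  [set u | exists xi eta, [/\ l2 xi, l2 eta & u = coefficient xi eta]].

(* VN(G): the closure of the span of the left translations in the weak
   operator topology of B(l^2(G)). *)
Definition group_vN : set ((G -> C) -> (G -> C)) :=
  [set x |
    [/\ forall (c : C) xi eta, l2 xi -> l2 eta ->
          x (fun s => c * xi s + eta s) = (fun s => c * x xi s + x eta s),
        exists M : R, forall xi, l2 xi ->
          (l2norm (x xi) <= M%:E * l2norm xi)%E &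
        forall m (xi eta : 'I_m -> G -> C) (e : R),
          (forall k, l2 (xi k)) -> (forall k, l2 (eta k)) -> 0 < e ->
          exists (J : seq G) (c : G -> C), forall k,
            rnorm (l2inner (x (xi k)) (eta k) -
              l2inner (fun s => \sum_(t <- J) c t * translation t (xi k) s)
                      (eta k)) < e]].

(* The duality <u, x> = (x xi, eta) between u in A(G), u(s) = (lambda_s xi, eta),
   and x in VN(G); it does not depend on the choice of xi and eta. *)
Definition fourier_pairing (u : G -> C) (x : (G -> C) -> (G -> C)) : C :=
  let p := xget (0, 0)
    [set p | [/\ l2 p.1, l2 p.2 & u = coefficient p.1 p.2]] in
  l2inner (x p.1) p.2.

(* The operator space structure of A(G) as the predual of VN(G):
   M_n(A(G)) is contained isometrically in CB(VN(G), M_n), and the matrix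
   [<u i j, x k l>] acts on C^n (x) C^m. *)
Definition fourier_mxnorm n (u : 'M[G -> C]_n) : \bar R :=
  ereal_sup [set y | exists m (x : 'M[(G -> C) -> (G -> C)]_m),
    [/\ forall k l, group_vN (x k l), (l2_mxnorm x <= 1)%E &
        y = mxopnorm (@enorm R C) (fun (p q : 'I_n * 'I_m) (z : C) =>
              fourier_pairing (u p.1 q.1) (x p.2 q.2) * z)]].

(* Norm of u |-> v u as a completely bounded map on A(G). *)
Definition herz_schur_norm (v : G -> C) : \bar R :=
  cb_norm fourier_algebra fourier_mxnorm fourier_mxnorm
    (fun u s => v s * u s).

Definition herz_schur (v : G -> C) : Prop :=
  (forall u, fourier_algebra u -> fourier_algebra (fun s => v s * u s)) /\
  (herz_schur_norm v < +oo)%E.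

Definition weakly_amenable_group : Prop :=
  exists (I : Type) (le : I -> I -> Prop) (v : I -> G -> C),
    [/\ directed le,
        forall i, herz_schur (v i) /\ finite_set [set t | v i t != 0],
        forall t, (fun i => rnorm (v i t - 1)) @ tails le --> (0 : R) &
        (ereal_sup [set herz_schur_norm (v i) | i in [set: I]] < +oo)%E].

End fourier_algebra.
Arguments weakly_amenable_group : clear implicits.

Lemma sum_single (K : numFieldType) (V : normedModType K) (I : choiceType)
    (i0 : I) (x : I -> V) : (forall i, i != i0 -> x i = 0) -> summability.sum x = x i0.
Proof.
move=> x0; rewrite /summability.sum.
have F := @summability.totally_filter I.
apply: cvg_lim; first exact: norm_hausdorff.
apply/(@cvgrPdist_lt K V _ summability.totally F) => e e0.
exists [fset i0]%fset => //= J; rewrite /= fsub1set => i0J.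
rewrite /summability.partial_sum (bigD1 [` i0J]%fset)//= big1.
  by rewrite addr0 subrr normr0.
move=> j ji.
by apply: x0; apply: contra ji => /eqP e1; apply/eqP/val_inj.
Qed.

Section crossed_product.
Variables (R : realType) (A : cstarAlgType R) (H : hilbertType R).
Variable rho : A -> H -> H.

Definition rep_mxnorm n (a : 'M[A]_n) : \bar R :=
  mxopnorm (@enorm R H) (fun i j => rho (a i j)).

(* The completely bounded norm of T : A -> A, for A contained in B(H). *)
Definition cbnormA (T : A -> A) : \bar R :=
  cb_norm [set: A] rep_mxnorm rep_mxnorm T.

Definition finite_rank (T : A -> A) : Prop :=
  exists n (b : 'I_n -> A), forall a, exists c : 'I_n -> R[i],
    T a = \sum_(i < n) c i *: b i.

Definition cbap_net (I : Type) (le : I -> I -> Prop)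
    (phi : I -> {linear A -> A}) : Prop :=
  [/\ directed le,
      forall i, finite_rank (phi i) /\ (cbnormA (phi i) < +oo)%E,
      forall a, (fun i => cnorm (phi i a - a)) @ tails le --> (0 : R) &
      (ereal_sup [set cbnormA (phi i) | i in [set: I]] < +oo)%E].

Variables (G : groupType) (alpha : G -> {lrmorphism A -> A}).

Definition crossed_pi (a : A) (xi : G -> H) : G -> H :=
  fun s => rho (alpha s^-1%g a) (xi s).

(* pi x| lambda (f), the series being evaluated pointwise *)
Definition integrated_form (f : G -> A) (xi : G -> H) : G -> H :=
  fun s => summability.sum (fun t => crossed_pi (f t) (translation t xi) s).

Definition mult_by (F : G -> {linear A -> A}) (f : G -> A) : G -> A :=
  fun s => F s (f s).

(* S_F, on the range of l^1(G, A) under the injective map integrated_form *)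
Definition mult_map (F : G -> {linear A -> A}) (x : (G -> H) -> (G -> H))
    : (G -> H) -> (G -> H) :=
  integrated_form
    (mult_by F (xget 0 [set f | l1 f /\ integrated_form f = x])).

(* The range of l^1(G, A) is norm dense in the reduced crossed product, so that
   this is also the completely bounded norm of the extension of S_F. *)
Definition hs_norm (F : G -> {linear A -> A}) : \bar R :=
  cb_norm (integrated_form @` @l1 R A G) (@l2_mxnorm R G H) (@l2_mxnorm R G H)
    (mult_map F).

Definition hs_multiplier (F : G -> {linear A -> A}) : Prop :=
  [/\ forall t, (cbnormA (F t) < +oo)%E,
      (ereal_sup [set cbnormA (F t) | t in [set: G]] < +oo)%E &
      (hs_norm F < +oo)%E].

Definition weakly_amenable_net (I : Type) (le : I -> I -> Prop)
    (F : I -> G -> {linear A -> A}) : Prop :=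
  [/\ directed le,
      forall i, hs_multiplier (F i) /\
        finite_set [set t | exists a, F i t a != 0],
      forall i t, finite_rank (F i t),
      forall t a, (fun i => cnorm (F i t a - a)) @ tails le --> (0 : R) &
      (ereal_sup [set hs_norm (F i) | i in [set: I]] < +oo)%E].

Hypotheses (hrho : is_faithful_rep rho) (halpha : is_action alpha).

Lemma integrated_form_inj : injective integrated_form.
Proof.
move=> f g fg; apply/funext => s.
have key f' (h : H) :
    integrated_form f' (fun t => if t == 1%g then h else 0) s =
    rho (alpha s^-1%g (f' s)) h.
  have r0 a : rho a 0 = 0.
    have := rep_linear hrho a (-1) 0 0; rewrite scaler0 addr0 => ->.
    by rewrite scaleN1r addNr.
  rewrite /integrated_form (@sum_single _ _ _ s) /crossed_pi /translation.
    by rewrite mulVg eqxx.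
  move=> t ts; case: ifP => // /eqP e.
  by move: ts; rewrite -(mulg1 t) -e mulgA mulgV mul1g eqxx.
apply: (bij_inj (action_bij halpha s^-1%g)); apply: (rep_inj hrho) => h.
by rewrite -!key fg.
Qed.

Lemma mult_mapE (F : G -> {linear A -> A}) (f : G -> A) : l1 f ->
  mult_map F (integrated_form f) = integrated_form (mult_by F f).
Proof.
move=> lf; rewrite /mult_map; congr (integrated_form (mult_by _ _)).
by case: xgetP => [g _ [_] /integrated_form_inj//|/(_ f)]; case.
Qed.

End crossed_product.

(* Main.v *)
(* A multiplier v of G acts on kernels by v(s t^-1).  Fell's absorption
   principle, i.e. conjugation of (b_kl) by diag(lambda_(s_k)), shows that
   (b_kl (x) lambda_(s_k s_l^-1)) has the norm of (b_kl); hence the Herz--Schur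
   norm of v on A(G) is the Schur multiplier norm of v(s_k s_l^-1) on finite
   matrices, with scalar entries or with operator entries.

   (i) => (ii): F(t) = v(t) phi.  On finite sections of the crossed product the
   equivariant map phi acts entrywise, and v acts as a Schur multiplier.

   (ii) => (i): phi = F(1), and v(t) = <F(t)(1) x0, x0> for a unit vector x0.
   By equivariance F(t)(1) is alpha-invariant, so compressing the image under
   S_F of the matrices (b_kl 1 (x) lambda_(s_k s_l^-1)) to the vectors
   x0 (x) delta_(s_l) exhibits v as a Schur multiplier.  The bound on F(1)
   needs every alpha_t to be completely isometric for the norm of B(H).  This
   is proved without spectral theory: if h = a* a and h <= r in B(H), then r - h
   is a square in A, because |h - r|, obtained by two convergent square root
   iterations, has the same image as r - h; the passage to matrices uses
   |b|^2 <= |b* b| repeatedly. *)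

Require Import Defs.
From mathcomp Require Import all_boot all_order all_algebra finmap.
From mathcomp Require Import all_classical all_reals all_analysis complex.
From mathcomp Require Import sesquilinear ring lra.
From mathcomp.analysis.showcase Require summability.

Set Implicit Arguments.
Unset Strict Implicit.
Unset Printing Implicit Defensive.

Import Order.TTheory GRing.Theory Num.Theory.
Import numFieldNormedType.Exports.

Local Open Scope classical_set_scope.
Local Open Scope ring_scope.
Local Open Scope complex_scope.

(** * Norms, inner products and orthonormal families *)

(** Every norm is reduced to a quadratic inequality between finite sums. A finitely supported
    multiplier couples a finite window of [G] only to a slightly larger one, so bounding finite
    sections uniformly bounds the operator. Passing from scalar to operator entries costs nothing:
    finitely many vectors are expanded in an orthonormal basis of their span, and the operator
    matrix becomes a larger scalar matrix whose symbol still depends on the group indices alone. The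
    Herz--Schur norm lives on A(G), so duality enters twice: point masses of A(G), paired with
    VN(G), are matrix entries of finite sections; and multiplication by [v] is dual to Schur
    multiplication on VN(G). That alpha_t preserves matrix norms is recast as a comparison of [rho]
    with a second faithful representation, [rho] composed with alpha_t. An operator inequality in
    the first becomes an identity z z = r - a* a inside [A], which the second then preserves. Since
    [rho] may be degenerate, [rho 1] is only a projection, and x0 must be chosen in its range. *)

Section rnorm_theory.
Variable R : realType.
Local Notation C := R[i].

Lemma rnormE (V : normedZmodType C) (x : V) : (rnorm x)%:C = `|x|.
Proof. by rewrite /rnorm RRe_real// ger0_real. Qed.

Lemma rnorm_ge0 (V : normedZmodType C) (x : V) : 0 <= rnorm x.
Proof. by rewrite -lecR rnormE normr_ge0. Qed.

Lemma rnorm0 (V : normedZmodType C) : rnorm (0 : V) = 0.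
Proof. by rewrite /rnorm normr0. Qed.

Lemma rnorm0_eq0 (V : normedZmodType C) (x : V) : rnorm x = 0 -> x = 0.
Proof. by move=> x0; apply/normr0_eq0; rewrite -rnormE x0. Qed.

Lemma rnormN (V : normedZmodType C) (x : V) : rnorm (- x) = rnorm x.
Proof. by rewrite /rnorm normrN. Qed.

Lemma ler_rnormD (V : normedZmodType C) (x y : V) :
  rnorm (x + y) <= rnorm x + rnorm y.
Proof. by rewrite -lecR rmorphD /= !rnormE ler_normD. Qed.

Lemma rnormZ (V : normedModType C) (c : C) (x : V) :
  rnorm (c *: x) = rnorm c * rnorm x.
Proof. by apply: complexI; rewrite rmorphM /= !rnormE normrZ. Qed.

Lemma rnormM (c x : C) : rnorm (c * x) = rnorm c * rnorm x.
Proof. by apply: complexI; rewrite rmorphM /= !rnormE normrM. Qed.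

Lemma rnorm1 : rnorm (1 : C) = 1.
Proof. by rewrite /rnorm normr1. Qed.

Lemma rnorm_real (r : R) : rnorm r%:C = `|r|.
Proof. by rewrite /rnorm normc_def /= expr0n addr0 sqrtr_sqr. Qed.

Lemma sqr_rnorm (c : C) : (rnorm c ^+ 2)%:C = c * Num.conj c.
Proof. by rewrite rmorphXn /= rnormE normCK. Qed.

Lemma rnorm_sum (V : normedZmodType C) (I : Type) (s : seq I) (P : pred I)
    (x : I -> V) :
  rnorm (\sum_(i <- s | P i) x i) <= \sum_(i <- s | P i) rnorm (x i).
Proof.
elim/big_rec2: _ => [|i r y _ h]; first by rewrite rnorm0.
by apply: le_trans (ler_rnormD _ _) _; rewrite lerD2l.
Qed.

Lemma sqr_rnormD (V : normedZmodType C) (x y : V) :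
  rnorm (x + y) ^+ 2 <= 2 * rnorm x ^+ 2 + 2 * rnorm y ^+ 2.
Proof.
apply: (@le_trans _ _ ((rnorm x + rnorm y) ^+ 2)).
  by rewrite ler_pXn2r ?nnegrE ?addr_ge0 ?rnorm_ge0// ler_rnormD.
have := sqr_ge0 (rnorm x - rnorm y); nra.
Qed.

End rnorm_theory.

Section inner_theory.
Variables (R : realType) (H : hilbertType R).
Implicit Types (x y z : H) (c : R[i]).

Definition ip x y : R[i] := inner x y.

Lemma innerDl x y z : ip (x + y) z = ip x z + ip y z.
Proof. exact: linearDl. Qed.

Lemma innerDr x y z : ip z (x + y) = ip z x + ip z y.
Proof. exact: linearDr. Qed.

Lemma innerZl c x y : ip (c *: x) y = c * ip x y.
Proof. exact: linearZl_LR. Qed.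

Lemma innerZr c x y : ip x (c *: y) = Num.conj c * ip x y.
Proof. exact: linearZr_LR. Qed.

Lemma inner_conj x y : ip y x = Num.conj (ip x y).
Proof. by rewrite /ip (hermC inner y x) expr0 mul1r. Qed.

Lemma inner0l x : ip 0 x = 0.
Proof. exact: linear0l. Qed.

Lemma inner0r x : ip x 0 = 0.
Proof. exact: linear0r. Qed.

Lemma innerNl x y : ip (- x) y = - ip x y.
Proof. exact: linearNl. Qed.

Lemma innerNr x y : ip x (- y) = - ip x y.
Proof. exact: linearNr. Qed.

Lemma inner_suml (I : Type) (s : seq I) (P : pred I) (x : I -> H) y :
  ip (\sum_(i <- s | P i) x i) y = \sum_(i <- s | P i) ip (x i) y.
Proof. exact: linear_sumlz. Qed.

Lemma inner_sumr (I : Type) (s : seq I) (P : pred I) (x : I -> H) y :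
  ip y (\sum_(i <- s | P i) x i) = \sum_(i <- s | P i) ip y (x i).
Proof. exact: linear_sumr. Qed.

Lemma inner_rnorm x : ip x x = (rnorm x ^+ 2)%:C.
Proof. by rewrite rmorphXn /= rnormE; apply/esym/normr_inner. Qed.

Lemma pythagoras x y : ip x y = 0 ->
  rnorm (x + y) ^+ 2 = rnorm x ^+ 2 + rnorm y ^+ 2.
Proof.
move=> xy; apply: complexI; rewrite rmorphD /= -!inner_rnorm innerDl !innerDr.
by rewrite xy (inner_conj x y) xy conjC0 addr0 add0r.
Qed.

Definition orthonormal d (e : 'I_d -> H) :=
  forall p q, ip (e p) (e q) = (p == q)%:R.

Section orthonormal_family.
Variables (d : nat) (e : 'I_d -> H).
Hypothesis e_on : orthonormal e.

Lemma inner_orthonormal_sum (z : 'I_d -> R[i]) p :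
  ip (\sum_q z q *: e q) (e p) = z p.
Proof.
rewrite inner_suml (bigD1 p)//= big1 ?addr0; last first.
  by move=> q qp; rewrite innerZl e_on (negbTE qp) mulr0.
by rewrite innerZl e_on eqxx mulr1.
Qed.

Lemma parseval (z : 'I_d -> R[i]) :
  rnorm (\sum_p z p *: e p) ^+ 2 = \sum_p rnorm (z p) ^+ 2.
Proof.
apply: complexI; rewrite -inner_rnorm inner_sumr rmorph_sum; apply: eq_bigr => p _.
by rewrite innerZr inner_orthonormal_sum mulrC -sqr_rnorm.
Qed.

Lemma bessel x : \sum_p rnorm (ip x (e p)) ^+ 2 <= rnorm x ^+ 2.
Proof.
rewrite -parseval; set y := \sum_p _.
have xy : ip (x - y) y = 0.
  rewrite {2}/y inner_sumr big1// => p _.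
  by rewrite innerZr innerDl innerNl inner_orthonormal_sum subrr mulr0.
have -> : rnorm x ^+ 2 = rnorm (x - y) ^+ 2 + rnorm y ^+ 2.
  by rewrite -pythagoras// subrK.
by rewrite lerDr sqr_ge0.
Qed.

End orthonormal_family.

(** Gives coordinates to finitely many vectors, so that operator inequalities become inequalities
    between scalar matrices. Dependent vectors are allowed: a vector already in the span adds
    nothing to the family. *)
Lemma gram_schmidt (s : seq H) : exists d (e : 'I_d -> H), orthonormal e /\
  forall w, w \in s -> w = \sum_p ip w (e p) *: e p.
Proof.
elim: s => [|w s [d [e [e_on es]]]].
  by exists 0%N, (fun=> 0); split => // -[].
pose y := w - \sum_p ip w (e p) *: e p.
have [y0|y0] := eqVneq y 0.
  exists d, e; split => // w'; rewrite inE => /predU1P[->|/es//].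
  by apply/eqP; rewrite -subr_eq0 -/y y0.
have ye p : ip y (e p) = 0.
  by rewrite innerDl innerNl inner_orthonormal_sum// subrr.
have ny0 : rnorm y != 0 by apply: contra y0 => /eqP/rnorm0_eq0 ->.
pose f := ((rnorm y)^-1)%:C *: y.
have fE : f = ((rnorm y)^-1)%:C *: y by [].
clearbody f.
have fe p : ip f (e p) = 0 by rewrite fE innerZl ye mulr0.
have ff : ip f f = 1.
  rewrite fE innerZl innerZr inner_rnorm.
  have -> : Num.conj ((rnorm y)^-1)%:C = ((rnorm y)^-1)%:C :> R[i].
    by rewrite conj_Creal// complex_real.
  by rewrite -!rmorphM /= expr2 mulrA mulrA -invfM -mulrA mulVf ?mulf_neq0.
pose e' (p : 'I_d.+1) := oapp e f (unlift ord0 p).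
have e'0 : e' ord0 = f by rewrite /e' unlift_none.
have e'S p : e' (lift ord0 p) = e p by rewrite /e' liftK.
have sumE w' : \sum_p ip w' (e' p) *: e' p =
    ip w' f *: f + \sum_p ip w' (e p) *: e p.
  rewrite big_ord_recl e'0; congr (_ + _).
  by apply: eq_bigr => p _; rewrite e'S.
exists d.+1, e'; split.
  move=> p q; case: (unliftP ord0 p) => [p'|] ->; case: (unliftP ord0 q) => [q'|] ->.
  - by rewrite !e'S e_on (inj_eq lift_inj).
  - by rewrite e'S e'0 (inner_conj f) (fe p') conjC0.
  - by rewrite e'S e'0 (fe q').
  - by rewrite e'0 ff eqxx.
move=> w'; rewrite inE sumE => /predU1P[->|w's]; last first.
  suff -> : ip w' f = 0 by rewrite scale0r add0r; exact: es.
  rewrite (es _ w's) inner_suml big1// => p _.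
  by rewrite innerZl (inner_conj f) fe conjC0 mulr0.
have -> : ip w f = (rnorm y)%:C.
  rewrite -{1}(subrK (\sum_p ip w (e p) *: e p) w) -/y innerDl.
  rewrite inner_suml [X in _ + X]big1 ?addr0; last first.
    by move=> p _; rewrite innerZl (inner_conj f) fe conjC0 mulr0.
  have {1}-> : y = (rnorm y)%:C *: f.
    by rewrite fE scalerA -rmorphM /= mulfV// scale1r.
  by rewrite innerZl ff mulr1.
by rewrite fE scalerA -rmorphM /= mulfV// scale1r subrK.
Qed.

Lemma rnorm_inner_le x u : rnorm u = 1 -> rnorm (ip x u) <= rnorm x.
Proof.
move=> u1; have e_on : orthonormal (fun _ : 'I_1 => u).
  by move=> p q; rewrite !ord1 inner_rnorm u1 expr1n.
have := bessel e_on x; rewrite big_ord1.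
by rewrite ler_pXn2r// nnegrE rnorm_ge0.
Qed.

End inner_theory.

(** * Norm bounds for finite matrices of operators *)

Section mxbound_theory.
Variable R : realType.
Local Notation C := R[i].

(** The squared form avoids roots and suprema, and an arbitrary finite index type admits products
    such as group positions times matrix indices without enumerating them. *)
Definition mxbound (V : normedZmodType C) (K : finType) (T : K -> K -> V -> V)
    (c : R) : Prop :=
  forall x : K -> V, \sum_k rnorm (\sum_l T k l (x l)) ^+ 2 <=
    c ^+ 2 * \sum_l rnorm (x l) ^+ 2.

Lemma mxbound_reindex (V : normedZmodType C) (K L : finType) (h : L -> K)
    (T : K -> K -> V -> V) c : bijective h ->
  mxbound (fun k l => T (h k) (h l)) c -> mxbound T c.
Proof.
move=> bh Tb x.
have reidx (W : nmodType) (F : K -> W) : \sum_k F k = \sum_l F (h l).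
  by rewrite (reindex h)//; exact: onW_bij.
rewrite !reidx; apply: le_trans (Tb (x \o h)).
by under eq_bigr do rewrite reidx.
Qed.

Lemma mxbound_enum (V : normedZmodType C) (K : finType) (T : K -> K -> V -> V) c :
  mxbound (fun k l : 'I_#|K| => T (enum_val k) (enum_val l)) c -> mxbound T c.
Proof. by apply: mxbound_reindex; exact: enum_val_bij. Qed.

End mxbound_theory.

(** * Extended norms on direct sums *)

Section extended_norms.
Variable R : realType.
Local Notation C := R[i].

Definition sql2 (I : choiceType) (V : normedZmodType C) (xi : I -> V) : \bar R :=
  (\esum_(i in [set: I]) ((rnorm (xi i)) ^+ 2)%:E)%E.

Lemma sql2_ge0 (I : choiceType) (V : normedZmodType C) (xi : I -> V) :
  (0 <= sql2 xi)%E.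
Proof. by apply: esum_ge0 => i _; rewrite lee_fin sqr_ge0. Qed.

Lemma poweR_half_sqr (y : \bar R) : (0 <= y)%E -> ((y `^ 2^-1) ^+ 2 = y)%E.
Proof.
case: y => [y| |]//.
  by rewrite lee_fin => y0; rewrite poweR12_sqrt// -[in RHS](sqr_sqrtr y0) EFin_expe.
by move=> _; rewrite poweRyr// expe2 mulyy.
Qed.

Lemma poweR_half_le (y : \bar R) (c : R) : (0 <= y)%E -> 0 <= c ->
  ((y `^ 2^-1 <= c%:E) = (y <= (c ^+ 2)%:E))%E.
Proof.
case: y => [y| |]//; last first.
  by move=> _ c0; rewrite poweRyr.
rewrite lee_fin => y0 c0; rewrite poweR12_sqrt//= !lee_fin.
by rewrite -[in RHS](sqr_sqrtr y0) ler_pXn2r// nnegrE sqrtr_ge0.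
Qed.

Lemma l2norm_sqr (I : choiceType) (V : normedZmodType C) (xi : I -> V) :
  ((l2norm xi) ^+ 2 = sql2 xi)%E.
Proof. exact/poweR_half_sqr/sql2_ge0. Qed.

Lemma l2P (I : choiceType) (V : normedZmodType C) (xi : I -> V) :
  l2 xi <-> (sql2 xi < +oo)%E.
Proof.
split=> [|h]; last by apply: poweR_lty.
by apply: lty_poweRy; rewrite invr_eq0 pnatr_eq0.
Qed.

Lemma dsumnorm_le (K : Type) (N : K -> \bar R) (J : finType) (x : J -> K) (c : R) :
  0 <= c -> (forall k, 0 <= N k)%E ->
  ((dsumnorm N x <= c%:E) = (\sum_j (N (x j)) ^+ 2 <= (c ^+ 2)%:E))%E.
Proof.
move=> c0 N0; apply: poweR_half_le => //; apply: sume_ge0 => j _.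
by rewrite expe_ge0.
Qed.

Lemma mxopnorm_leP (K : zmodType) (N : K -> \bar R) (J : finType)
    (T : J -> J -> K -> K) (c : R) : 0 <= c -> (forall k, 0 <= N k)%E ->
  (mxopnorm N T <= c%:E)%E <->
  (forall x : J -> K, (\sum_j (N (x j)) ^+ 2 <= 1)%E ->
     (\sum_i (N (\sum_j T i j (x j))%R) ^+ 2 <= (c ^+ 2)%:E)%E).
Proof.
move=> c0 N0; split=> [h x x1|h].
  rewrite -dsumnorm_le//; apply: le_trans h; apply: ereal_sup_ubound.
  by exists x => //=; rewrite dsumnorm_le// expr1n.
apply: ge_ereal_sup => _ [x /= x1 <-]; rewrite dsumnorm_le//; apply: h.
by move: x1; rewrite dsumnorm_le// expr1n.
Qed.

Lemma enorm_sqr (V : normedZmodType C) (J : finType) (x : J -> V) :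
  (\sum_j (enorm (x j)) ^+ 2)%E = (\sum_j rnorm (x j) ^+ 2)%:E.
Proof. by rewrite -sumEFin; apply: eq_bigr => j _; rewrite EFin_expe. Qed.

(** Homogeneity carries the bound from the unit ball to all vectors, by rescaling with the inverse
    of the norm; the zero vector cannot be rescaled and is treated first. *)
Lemma mxopnorm_enormP (V : normedModType C) (J : finType)
    (T : J -> J -> V -> V) (c : R) : 0 <= c ->
  (forall i j z x, T i j (z *: x) = z *: T i j x) ->
  (mxopnorm (@enorm R V) T <= c%:E)%E <-> mxbound T c.
Proof.
move=> c0 TZ; have N0 (x : V) : (0 <= enorm x)%E by rewrite lee_fin rnorm_ge0.
split=> [/(mxopnorm_leP _ c0 N0) h x|h]; last first.
  apply/mxopnorm_leP => // x; rewrite !enorm_sqr !lee_fin => x1.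
  by apply: le_trans (h x) _; rewrite ler_piMr ?sqr_ge0.
set S := \sum_l rnorm (x l) ^+ 2.
have S0 : 0 <= S by apply: sumr_ge0 => l _; exact: sqr_ge0.
have [S00|Sn0] := eqVneq S 0.
  have x0 l : x l = 0.
    apply: rnorm0_eq0; apply/eqP; rewrite -sqrf_eq0.
    by have := psumr_eq0P _ S00 => -> // i _; rewrite sqr_ge0.
  rewrite S00 mulr0 big1// => k _; rewrite big1 ?rnorm0 ?expr0n// => l _.
  by rewrite x0 -[X in T _ _ X](scale0r 0) TZ scale0r.
pose r := (Num.sqrt S)^-1.
have r0 : 0 <= r by rewrite invr_ge0 sqrtr_ge0.
have r2 : r ^+ 2 * S = 1 by rewrite exprVn sqr_sqrtr// mulVf.
have scaleE (y : J -> V) : \sum_j rnorm (r%:C *: y j) ^+ 2 =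
    r ^+ 2 * \sum_j rnorm (y j) ^+ 2.
  rewrite mulr_sumr; apply: eq_bigr => j _.
  by rewrite rnormZ rnorm_real ger0_norm// exprMn.
have := h (fun l => r%:C *: x l); rewrite !enorm_sqr scaleE r2 lexx => /(_ isT).
under eq_bigr => i _.
  under eq_bigr => j _ do rewrite TZ.
  rewrite -scaler_sumr; over.
rewrite lee_fin scaleE => /(ler_wpM2r S0).
by rewrite mulrAC r2 mul1r.
Qed.

Lemma l2_mxnorm_leP (I : choiceType) (V : normedZmodType C) n
    (X : 'M[(I -> V) -> (I -> V)]_n) (c : R) : 0 <= c ->
  (l2_mxnorm X <= c%:E)%E <->
  (forall xi : 'I_n -> I -> V, (\sum_j sql2 (xi j) <= 1)%E ->
     (\sum_i sql2 (\sum_j X i j (xi j))%R <= (c ^+ 2)%:E)%E).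
Proof.
move=> c0; rewrite /l2_mxnorm mxopnorm_leP//; last by move=> xi; exact: poweR_ge0.
split=> h xi; have := h xi; rewrite (eq_bigr _ (fun j _ => l2norm_sqr (xi j)));
  by rewrite (eq_bigr _ (fun j _ => l2norm_sqr _)).
Qed.

Lemma cb_norm_leP (X Y : Type) (D : set X) (NX : forall n, 'M[X]_n -> \bar R)
    (NY : forall n, 'M[Y]_n -> \bar R) (T : X -> Y) (c : \bar R) :
  (cb_norm D NX NY T <= c)%E <->
  (forall n (a : 'M[X]_n), (forall i j, D (a i j)) -> (NX n a <= 1)%E ->
     (NY n (map_mx T a) <= c)%E).
Proof.
split=> [h n a Da a1|h].
  by apply: le_trans h; apply: ereal_sup_ubound; exists n, a; split.
by apply: ge_ereal_sup => _ [n [a [Da a1 ->]]]; exact: h.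
Qed.

Section finite_support.
Variables (I : choiceType) (V : normedZmodType C).

Lemma sql2_fsupp (s : seq I) (xi : I -> V) : uniq s ->
  (forall i, i \notin s -> xi i = 0) ->
  sql2 xi = (\sum_(i <- s) rnorm (xi i) ^+ 2)%:E.
Proof.
move=> us xis; transitivity (\esum_(i in [set` s]) ((rnorm (xi i)) ^+ 2)%:E)%E.
  rewrite [RHS]esum_mkcond; apply: eq_esum => i _; case: ifPn => //.
  rewrite notin_setE /= => /negP ins.
  by rewrite xis ?rnorm0 ?expr0n.
rewrite esum_fset//; last by move=> i _; rewrite lee_fin sqr_ge0.
by rewrite -fsbig_seq// sumEFin.
Qed.

(** One finite window serves all [j], because the finite sum over [j] can be moved inside the
    unordered sum. *)
Lemma sum_sql2_le (J : finType) (xi : J -> I -> V) (c : R) :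
  (forall s : seq I, uniq s ->
     \sum_j \sum_(i <- s) rnorm (xi j i) ^+ 2 <= c) ->
  (\sum_j sql2 (xi j) <= c%:E)%E.
Proof.
move=> h; rewrite -esum_sum; last by move=> *; rewrite lee_fin sqr_ge0.
apply: ge_ereal_sup => _ [F [finF _] <-].
rewrite fsbig_finite//= exchange_big /=.
under eq_bigr do rewrite sumEFin.
by rewrite sumEFin lee_fin h// fset_uniq.
Qed.

Lemma sum_sql2_ge (J : finType) (xi : J -> I -> V) (s : seq I) : uniq s ->
  ((\sum_j \sum_(i <- s) rnorm (xi j i) ^+ 2)%:E <= \sum_j sql2 (xi j))%E.
Proof.
move=> us; rewrite -sumEFin; apply: lee_sum => j _.
apply: esum_ge; exists [set` s]; first by split.
by rewrite -fsbig_seq// sumEFin.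
Qed.

Lemma sql2_reindex (h : I -> I) (xi : I -> V) : bijective h ->
  sql2 (xi \o h) = sql2 xi.
Proof.
move=> [g hK gK]; rewrite /sql2.
rewrite [RHS](@reindex_esum _ _ _ [set: I] [set: I] h)//.
by rewrite setTT_bijective; exact: (Bijective hK gK).
Qed.

Lemma sql2_leP (xi : I -> V) (a : R) : (sql2 xi <= a%:E)%E <->
  (forall s : seq I, uniq s -> \sum_(i <- s) rnorm (xi i) ^+ 2 <= a).
Proof.
split=> [h s us|h].
  have := sum_sql2_ge (fun _ : 'I_1 => xi) us.
  by rewrite !big_ord1 => h1; have := le_trans h1 h; rewrite lee_fin.
suff : (\sum_(j < 1) sql2 xi <= a%:E)%E by rewrite big_ord1.
by apply: sum_sql2_le => s us; rewrite big_ord1 h.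
Qed.

Lemma sql2D (xi eta : I -> V) (a b : R) : (sql2 xi <= a%:E)%E ->
  (sql2 eta <= b%:E)%E ->
  (sql2 (fun i => (xi i + eta i)%R) <= (2 * a + 2 * b)%:E)%E.
Proof.
move=> /sql2_leP xia /sql2_leP etab; apply/sql2_leP => s us.
apply: (@le_trans _ _ (\sum_(i <- s) (2 * rnorm (xi i) ^+ 2 + 2 * rnorm (eta i) ^+ 2))).
  by apply: ler_sum => i _; exact: sqr_rnormD.
by rewrite big_split/= -!mulr_sumr lerD// ler_wpM2l// ?xia ?etab.
Qed.

End finite_support.

Lemma sql2Z (I : choiceType) (V : normedModType C) (xi : I -> V) (c : C) (a : R) :
  (sql2 xi <= a%:E)%E -> (sql2 (fun i => c *: xi i) <= (rnorm c ^+ 2 * a)%:E)%E.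
Proof.
move=> /sql2_leP h; apply/sql2_leP => s us.
under eq_bigr do rewrite rnormZ exprMn.
by rewrite -mulr_sumr ler_wpM2l ?sqr_ge0// h.
Qed.

Lemma l2_real (I : choiceType) (V : normedZmodType C) (xi : I -> V) :
  l2 xi <-> exists a : R, (sql2 xi <= a%:E)%E.
Proof.
split=> [/l2P h|[a h]]; last by apply/l2P; apply: le_lt_trans h _; exact: ltry.
exists (fine (sql2 xi)); rewrite fineK// ge0_fin_numE//; exact: sql2_ge0.
Qed.

Lemma sql2_translation (G : groupType) (V : normedZmodType C) (t : G)
    (xi : G -> V) : sql2 (translation t xi) = sql2 xi.
Proof.
rewrite -(sql2_reindex xi (h := fun s => (t^-1 * s)%g))//.
by exists (fun s => (t * s)%g) => s; rewrite mulgA ?mulVg ?mulgV mul1g.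
Qed.

End extended_norms.

(** * Summation over discrete sets *)

Section finite_summability.
Variables (K : numFieldType) (V : normedModType K) (I : choiceType).

Lemma partial_sumE (x : I -> V) (J : {fset I}) :
  summability.partial_sum x J = \sum_(i <- J) x i.
Proof. by rewrite big_seq_fsetE. Qed.

Lemma sum_finite (s : seq I) (x : I -> V) : uniq s ->
  (forall i, i \notin s -> x i = 0) -> summability.sum x = \sum_(i <- s) x i.
Proof.
move=> us xs; rewrite /summability.sum.
have F := @summability.totally_filter I.
apply: cvg_lim; first exact: norm_hausdorff.
apply/(@cvgrPdist_lt K V _ summability.totally F) => e e0.
exists [fset i in s]%fset => //= J /fsubsetP sJ.
suff -> : summability.partial_sum x J = \sum_(i <- s) x i by rewrite subrr normr0.
rewrite partial_sumE (bigID [pred i | i \in s])/= [X in _ + X]big1 ?addr0; last first.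
  by move=> i /xs.
rewrite -big_filter; apply: perm_big; apply: uniq_perm => //.
  by rewrite filter_uniq// fset_uniq.
move=> i; rewrite mem_filter; case: (boolP (i \in s)) => //= si.
by rewrite sJ// inE.
Qed.

Lemma sum_linear (x y : I -> V) (c : K) :
  cvg (summability.partial_sum x @ summability.totally) ->
  cvg (summability.partial_sum y @ summability.totally) ->
  cvg (summability.partial_sum (fun i => c *: x i + y i) @ summability.totally) /\
  summability.sum (fun i => c *: x i + y i) =
  c *: summability.sum x + summability.sum y.
Proof.
move=> cx cy; have F := @summability.totally_filter I.
have E : summability.partial_sum (fun i => c *: x i + y i) =
    (fun J => c *: summability.partial_sum x J + summability.partial_sum y J).
  apply/funext => J; rewrite !partial_sumE scaler_sumr -big_split.
  by apply: eq_bigr.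
have h : (fun J => c *: summability.partial_sum x J + summability.partial_sum y J) @
    summability.totally --> c *: summability.sum x + summability.sum y.
  by apply: cvgD => //; apply: cvgZl_tmp.
rewrite /summability.sum E; split; first by apply/cvg_ex; eexists; exact: h.
by apply: cvg_lim h; exact: norm_hausdorff.
Qed.

End finite_summability.

Section l2_inner.
Variables (R : realType) (I : choiceType).
Local Notation C := R[i].

(** Partial sums of squares increase, so they converge to their supremum; [polarization] reduces all
    inner products to this case. *)
Lemma cvg_sqr_norm (xi : I -> C) : l2 xi ->
  cvg (summability.partial_sum (fun i => ((rnorm (xi i) ^+ 2)%:C : C^o)) @
       summability.totally).
Proof.
move=> /l2_real[a /sql2_leP xia].
pose f (J : {fset I}) := \sum_(i <- J) rnorm (xi i) ^+ 2.
have fub : has_sup (range f).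
  split; first by exists (f fset0), fset0.
  by exists a => _ [J _ <-]; apply: xia; exact: fset_uniq.
have F := @summability.totally_filter I.
apply/cvg_ex; exists ((sup (range f))%:C : C^o).
apply/(@cvgrPdist_lt C C^o _ summability.totally F) => e e0.
have [e1 e1E] : exists e1, e = e1%:C.
  by apply/complex_realP; rewrite gtr0_real.
rewrite e1E ltcR in e0 *.
have [_ [J0 _ <-] J0e] := sup_adherent e0 fub.
exists J0 => //= J /fsubsetP J0J.
have -> : summability.partial_sum (fun i => ((rnorm (xi i) ^+ 2)%:C : C^o)) J = (f J)%:C.
  by rewrite partial_sumE /f rmorph_sum.
have fJ : f J <= sup (range f) by apply: sup_upper_bound => //; exists J.
have fJ0 : f J0 <= f J.
  rewrite /f [leRHS](bigID [pred i | i \in J0])/=.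
  apply: (@le_trans _ _ (\sum_(i <- J | i \in J0) rnorm (xi i) ^+ 2)); last first.
    by rewrite lerDl; apply: sumr_ge0 => i _; exact: sqr_ge0.
  rewrite -[leRHS]big_filter le_eqVlt; apply/orP; left; apply/eqP/perm_big/uniq_perm.
  - exact: fset_uniq.
  - by rewrite filter_uniq// fset_uniq.
  - by move=> i; rewrite mem_filter; case: (boolP (i \in J0)) => //= /J0J.
rewrite -rmorphB /= -rnormE rnorm_real ltcR ger0_norm ?subr_ge0//.
by rewrite ltrBlDr -ltrBlDl; apply: lt_le_trans fJ0.
Qed.

Lemma polarization (a b : C) : a * Num.conj b =
  (4^-1 * (rnorm (a + b) ^+ 2)%:C - 4^-1 * (rnorm (a - b) ^+ 2)%:C) +
  (4^-1 * 'i * (rnorm (a + 'i * b) ^+ 2)%:C - 4^-1 * 'i * (rnorm (a - 'i * b) ^+ 2)%:C).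
Proof.
(* Primed letters stand for conjugates, and [- i] for the conjugate of [i]. The identity is then
   purely algebraic and uses only the square of [i]. *)
have key (F : numFieldType) (i x y x' y' : F) : i * i = -1 -> x * y' =
    (4^-1 * ((x + y) * (x' + y')) - 4^-1 * ((x - y) * (x' - y'))) +
    (4^-1 * i * ((x + i * y) * (x' + (- i) * y')) -
     4^-1 * i * ((x - i * y) * (x' - (- i) * y'))).
  move=> i2.
  have -> : x * y' = 4^-1 * (2 * (x * y' + y * x')) -
      4^-1 * (2 * (i * i * (x * y' - y * x'))) by rewrite i2; field.
  by ring.
rewrite !sqr_rnorm !(rmorphD, rmorphN, rmorphM) /= conjCi.
by apply: key; rewrite -expr2 sqrCi.
Qed.

Lemma l2_lin (xi eta : I -> C) (c : C) : l2 xi -> l2 eta ->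
  l2 (fun i => c * xi i + eta i).
Proof.
move=> /l2_real[a xia] /l2_real[b etab]; apply/l2_real.
by exists (2 * (rnorm c ^+ 2 * a) + 2 * b); apply: sql2D etab; exact: (@sql2Z R I C^o).
Qed.

Lemma l2_0 : l2 (fun _ : I => 0 : C).
Proof.
apply/l2_real; exists 0; apply/sql2_leP => s _.
by rewrite big1// => i _; rewrite rnorm0 expr0n.
Qed.

Lemma l2_sum (J : Type) (s : seq J) (c : J -> C) (xi : J -> I -> C) :
  (forall j, l2 (xi j)) -> l2 (fun i => \sum_(j <- s) c j * xi j i).
Proof.
move=> l; elim: s => [|j s ih].
  by have := l2_0; congr l2; apply/funext => i; rewrite big_nil.
have := l2_lin (c j) (l j) ih.
by congr l2; apply/funext => i; rewrite big_cons.
Qed.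

Definition is_cvg_sum (x : I -> C) :=
  cvg (summability.partial_sum (x : I -> C^o) @ summability.totally).

Lemma sum_lin (x y : I -> C) (c : C) : is_cvg_sum x -> is_cvg_sum y ->
  is_cvg_sum (fun i => c * x i + y i) /\
  summability.sum ((fun i => c * x i + y i) : I -> C^o) =
  c * summability.sum (x : I -> C^o) + summability.sum (y : I -> C^o).
Proof. exact: (@sum_linear C C^o I). Qed.

End l2_inner.

(** * The group von Neumann algebra and its predual *)

Section l2_inner_theory.
Variables (R : realType) (G : groupType).
Local Notation C := R[i].
Implicit Types (xi eta : G -> C).

Lemma l2inner_cvg xi eta : l2 xi -> l2 eta ->
  is_cvg_sum (fun s => xi s * Num.conj (eta s)).
Proof.
move=> lx le.
pose S (c : C) s : C := (rnorm (xi s + c * eta s) ^+ 2)%:C.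
have sq (c : C) : is_cvg_sum (S c).
  apply: cvg_sqr_norm; have := l2_lin c le lx.
  by congr l2; apply/funext => s; rewrite addrC.
have lin (x y : G -> C) (c : C) : is_cvg_sum x -> is_cvg_sum y ->
    is_cvg_sum (fun s : G => c * x s + y s).
  by move=> cx cy; have [] := sum_lin c cx cy.
have cvg0 : is_cvg_sum (fun _ : G => 0 : C).
  apply/cvg_ex; exists (0 : C^o).
  have F := @summability.totally_filter G.
  have -> : summability.partial_sum ((fun=> 0) : G -> C^o) = fun=> 0.
    by apply/funext => J; rewrite partial_sumE big1.
  exact: cvg_cst.
have := lin _ _ 4^-1 (sq 1) (lin _ _ (- 4^-1) (sq (-1))
  (lin _ _ (4^-1 * 'i) (sq 'i) (lin _ _ (- (4^-1 * 'i)) (sq (- 'i)) cvg0))).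
congr is_cvg_sum; apply/funext => s.
by rewrite polarization addr0 /S !mul1r !mulN1r !mulNr !addrA.
Qed.

Lemma l2inner_lin xi1 xi2 eta (c : C) : l2 xi1 -> l2 xi2 -> l2 eta ->
  l2inner (fun s => c * xi1 s + xi2 s) eta = c * l2inner xi1 eta + l2inner xi2 eta.
Proof.
move=> l1 l2' le; have [_] := sum_lin c (l2inner_cvg l1 le) (l2inner_cvg l2' le).
rewrite -!/(l2inner _ _) => <-; congr (@summability.sum _ _ C^o _).
by apply/funext => s; rewrite mulrDl mulrA.
Qed.

Lemma l2inner0l eta : l2inner (fun=> 0) eta = 0.
Proof.
rewrite /l2inner (@sum_finite C C^o G [::])// => [|i _]; last by rewrite mul0r.
by rewrite big_nil.
Qed.

Lemma l2inner_sum (J : Type) (s : seq J) (c : J -> C) (xi : J -> G -> C) eta :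
  (forall j, l2 (xi j)) -> l2 eta ->
  l2inner (fun g => \sum_(j <- s) c j * xi j g) eta =
  \sum_(j <- s) c j * l2inner (xi j) eta.
Proof.
move=> lx le; elim: s => [|j s ih].
  rewrite big_nil -[RHS](l2inner0l eta); congr l2inner.
  by apply/funext => g; rewrite big_nil.
rewrite big_cons -ih -l2inner_lin//; last exact: l2_sum.
by congr l2inner; apply/funext => g; rewrite big_cons.
Qed.

Lemma l2_translation t xi : l2 xi -> l2 (translation t xi).
Proof. by move=> /l2P h; apply/l2P; rewrite sql2_translation. Qed.

Definition delta (g : G) : G -> C := fun s => (s == g)%:R.

Lemma sql2_delta g : sql2 (delta g) = 1%E.
Proof.
rewrite (@sql2_fsupp _ _ _ [:: g])//= => [|s].
  by rewrite big_seq1 /delta eqxx rnorm1 expr1n.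
by rewrite inE /delta => /negbTE ->.
Qed.

Lemma l2_delta g : l2 (delta g).
Proof. by apply/l2P; rewrite sql2_delta ltry. Qed.

Lemma l2_fsupp (s : seq G) xi : uniq s -> (forall g, g \notin s -> xi g = 0) -> l2 xi.
Proof. by move=> us xs; apply/l2P; rewrite (sql2_fsupp us xs) ltry. Qed.

Lemma l2inner_deltar xi g : l2inner xi (delta g) = xi g.
Proof.
rewrite /l2inner (@sum_finite C C^o G [:: g])//= => [|s].
  by rewrite big_seq1 /delta eqxx conjC1 mulr1.
by rewrite inE /delta => /negbTE ->; rewrite conjC0 mulr0.
Qed.

Lemma l2inner_deltal eta g : l2inner (delta g) eta = Num.conj (eta g).
Proof.
rewrite /l2inner (@sum_finite C C^o G [:: g])//= => [|s].
  by rewrite big_seq1 /delta eqxx mul1r.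
by rewrite inE /delta => /negbTE ->; rewrite mul0r.
Qed.

Lemma translation_delta t g : translation t (delta g) = delta (t * g)%g.
Proof.
apply/funext => s; rewrite /translation /delta; congr (_ %:R).
by congr nat_of_bool; apply/eqP/eqP => [<-|->]; rewrite mulgA ?mulgV ?mulVg mul1g.
Qed.

Lemma coefficient_deltal g eta t :
  coefficient (delta g) eta t = Num.conj (eta (t * g)%g).
Proof. by rewrite /coefficient translation_delta l2inner_deltal. Qed.

(** Such a function is the coefficient of [delta 1] against its own conjugate. *)
Lemma fourier_algebra_fsupp (s : seq G) (u : G -> C) : uniq s ->
  (forall t, t \notin s -> u t = 0) -> fourier_algebra u.
Proof.
move=> us u0; exists (delta 1%g), (fun t => Num.conj (u t)); split.
- exact: l2_delta.
- by apply: (l2_fsupp us) => g gs; rewrite u0// conjC0.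
- by apply/funext => t; rewrite coefficient_deltal mulg1 conjCK.
Qed.

(** Group algebra elements, in the shape of the approximants of [group_vN]; they belong to it with
    error zero. *)
Definition lcomb (s : seq G) (c : G -> C) : (G -> C) -> (G -> C) :=
  fun xi g => \sum_(t <- s) c t * translation t xi g.

Lemma l2inner_lcomb s (c : G -> C) xi eta : l2 xi -> l2 eta ->
  l2inner (lcomb s c xi) eta = \sum_(t <- s) c t * coefficient xi eta t.
Proof. by move=> lx le; rewrite l2inner_sum// => t; exact: l2_translation. Qed.

Lemma lcomb_lin s (c : G -> C) (z : C) xi eta :
  lcomb s c (fun g => z * xi g + eta g) =
  (fun g => z * lcomb s c xi g + lcomb s c eta g).
Proof.
apply/funext => g; rewrite /lcomb mulr_sumr -big_split; apply: eq_bigr => t _ /=.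
by rewrite /translation mulrDr mulrCA.
Qed.

Lemma lcomb_bounded s (c : G -> C) : exists M : R, forall xi (a : R),
  (sql2 xi <= a%:E)%E -> (sql2 (lcomb s c xi) <= (M * a)%:E)%E.
Proof.
elim: s => [|t s [M h]].
  exists 0 => xi a _; apply/sql2_leP => s _; rewrite mul0r big1// => g _.
  by rewrite /lcomb big_nil rnorm0 expr0n.
exists (2 * rnorm (c t) ^+ 2 + 2 * M) => xi a xia.
have -> : lcomb (t :: s) c xi = fun g => c t * translation t xi g + lcomb s c xi g.
  by apply/funext => g; rewrite /lcomb big_cons.
rewrite mulrDl -(mulrA 2 (_ ^+ 2)) -(mulrA 2 M); apply: sql2D; last exact: h.
apply: (@sql2Z R G C^o (translation t xi) (c t) a).
by rewrite -(sql2_translation t) in xia.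
Qed.

Lemma lcomb_group_vN s (c : G -> C) : group_vN (lcomb s c).
Proof.
split; first by move=> z xi eta _ _; exact: lcomb_lin.
- have [M h] := lcomb_bounded s c.
  (* [lcomb_bounded] gives no sign for [M], hence the maximum with 0 before taking the root. *)
  exists (Num.sqrt (Num.max M 0)) => xi /l2P lx.
  have [a aE] : exists a, sql2 xi = a%:E.
    by exists (fine (sql2 xi)); rewrite fineK// ge0_fin_numE// sql2_ge0.
  have a0 : 0 <= a by rewrite -lee_fin -aE sql2_ge0.
  rewrite /l2norm -!/(sql2 _) aE [X in (_ <= _ * X)%E](_ : _ = (Num.sqrt a)%:E);
    last by rewrite poweR12_sqrt.
  rewrite -EFinM -sqrtrM ?le_max ?lexx ?orbT//.
  rewrite poweR_half_le ?sql2_ge0 ?sqrtr_ge0// sqr_sqrtr ?mulr_ge0 ?le_max ?lexx ?orbT//.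
  apply: le_trans (h xi a _) _; first by rewrite aE.
  by rewrite lee_fin ler_wpM2r// le_max lexx.
- move=> m xi eta e lx le e0; exists s, c => k.
  by rewrite /lcomb subrr rnorm0.
Qed.

(** The hypothesis says that a functional vanishes on all translations, hence on their linear
    combinations, hence on weak limits of these. This makes the pairing of A(G) with VN(G) well
    defined. *)
Lemma group_vN_relation x m (xi eta : 'I_m -> G -> C) (z : 'I_m -> C) :
  group_vN x -> (forall k, l2 (xi k)) -> (forall k, l2 (eta k)) ->
  (forall t, \sum_k z k * coefficient (xi k) (eta k) t = 0) ->
  \sum_k z k * l2inner (x (xi k)) (eta k) = 0.
Proof.
move=> [_ _ xap] lx le z0; apply: rnorm0_eq0; apply/eqP.
rewrite eq_le rnorm_ge0 andbT; apply/ler_addgt0Pr => e e0; rewrite add0r.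
(* Each approximation is made within [e / K], so the weighted errors add up to at most [e]; the
   summand 1 keeps [K] positive when all weights vanish. *)
pose K := 1 + \sum_k rnorm (z k).
have K0 : 0 < K.
  by rewrite ltr_pwDl// sumr_ge0// => k _; exact: rnorm_ge0.
have [J [c h]] := xap m xi eta (e / K) lx le (divr_gt0 e0 K0).
have -> : \sum_k z k * l2inner (x (xi k)) (eta k) =
    \sum_k z k * (l2inner (x (xi k)) (eta k) - l2inner (lcomb J c (xi k)) (eta k)).
  under [RHS]eq_bigr do rewrite mulrBr; rewrite big_split/= sumrN.
  under [X in _ - X]eq_bigr do rewrite l2inner_lcomb// mulr_sumr.
  rewrite exchange_big [X in _ - X]big1 ?subr0// => t _.
  under eq_bigr do rewrite mulrCA.
  by rewrite -mulr_sumr z0 mulr0.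
apply: le_trans (rnorm_sum _ _ _) _.
apply: (@le_trans _ _ (\sum_k rnorm (z k) * (e / K))).
  by apply: ler_sum => k _; rewrite rnormM ler_wpM2l ?rnorm_ge0// ltW.
rewrite -mulr_suml mulrCA ler_piMr ?(ltW e0)// ler_pdivrMr// mul1r.
by rewrite lerDr.
Qed.

(** The pair picked by [xget] and the given pair have the same coefficient function, so the
    difference of the two values is a relation with weights 1 and -1. *)
Lemma fourier_pairingE x xi eta : group_vN x -> l2 xi -> l2 eta ->
  fourier_pairing (coefficient xi eta) x = l2inner (x xi) eta.
Proof.
move=> xN lx le; rewrite /fourier_pairing; case: xgetP => [[xi' eta'] _ /=|/(_ (xi, eta))].
  move=> [lx' le' E].
  have := @group_vN_relation x 2 (fun k => if k == ord0 then xi' else xi)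
    (fun k => if k == ord0 then eta' else eta)
    (fun k => if k == ord0 then 1 else -1) xN.
  rewrite !big_ord_recl big_ord0 /= addr0 mul1r mulN1r => h.
  apply/eqP; rewrite -subr_eq0; apply/eqP; apply: h.
  - by move=> k; case: ifP.
  - by move=> k; case: ifP.
  move=> t; rewrite !big_ord_recl big_ord0 /= addr0 mul1r mulN1r.
  by rewrite -E subrr.
by move=> h; exfalso; apply: h.
Qed.

Lemma fourier_pairing_lcomb s (c u : G -> C) : fourier_algebra u ->
  fourier_pairing u (lcomb s c) = \sum_(t <- s) c t * u t.
Proof.
move=> [xi [eta [lx le ->]]]; rewrite fourier_pairingE ?l2inner_lcomb//.
exact: lcomb_group_vN.
Qed.

End l2_inner_theory.

(** * Schur multipliers *)

Section finite_sums.

Lemma eq_big_supp (I : choiceType) (V : nmodType) (s t : seq I) (f : I -> V) :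
  uniq s -> uniq t -> (forall i, i \in s -> i \notin t -> f i = 0) ->
  (forall i, i \in t -> i \notin s -> f i = 0) ->
  \sum_(i <- s) f i = \sum_(i <- t) f i.
Proof.
move=> us ut st ts.
have aux (r r' : seq I) : (forall i, i \in r -> i \notin r' -> f i = 0) ->
    \sum_(i <- r) f i = \sum_(i <- [seq i <- r | i \in r']) f i.
  move=> h; rewrite big_filter [LHS](bigID [pred i | i \in r'])/=.
  by rewrite [X in _ + X]big_seq_cond [X in _ + X]big1 ?addr0// => i /andP[/h].
rewrite (aux s t)// (aux t s)//; apply/perm_big/uniq_perm; rewrite ?filter_uniq//.
by move=> i; rewrite !mem_filter andbC.
Qed.

Lemma ler_sum_sub (R : numDomainType) (I : choiceType) (s t : seq I) (f : I -> R) :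
  uniq s -> uniq t -> {subset s <= t} -> (forall i, 0 <= f i) ->
  \sum_(i <- s) f i <= \sum_(i <- t) f i.
Proof.
move=> us ut st f0.
rewrite [leRHS](bigID [pred i | i \in s])/= -[X in X + _]big_filter.
rewrite (@eq_big_supp _ _ [seq i <- t | i \in s] s)//.
- by rewrite lerDl sumr_ge0.
- by rewrite filter_uniq.
- by move=> i; rewrite mem_filter => /andP[->].
- by move=> i si; rewrite mem_filter si st.
Qed.

(** The substitution r = t^-1 g turns a combination of translations into a row of the kernel indexed
    by g r^-1. The last two hypotheses ensure that [S] and the window [J] contain every index that
    contributes. *)
Lemma sum_convolution (G : groupType) (V : nmodType) (S J : seq G) (g : G)
    (f : G -> G -> V) : uniq S -> uniq J ->
  (forall t, t \notin S -> f t (t^-1 * g)%g = 0) ->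
  (forall t, t \in S -> (t^-1 * g)%g \notin J -> f t (t^-1 * g)%g = 0) ->
  \sum_(t <- S) f t (t^-1 * g)%g = \sum_(r <- J) f (g * r^-1)%g r.
Proof.
move=> uS uJ fS fJ.
have gg t : (g * (t^-1 * g)^-1)%g = t by rewrite invgM invgK mulgA mulgV mul1g.
have gK r : ((g * r^-1)^-1 * g)%g = r by rewrite invgM invgK -mulgA mulVg mulg1.
transitivity (\sum_(r <- [seq (t^-1 * g)%g | t <- S]) f (g * r^-1)%g r).
  by rewrite big_map; apply: eq_bigr => t _; rewrite gg.
apply: eq_big_supp => //.
- by rewrite map_inj_uniq// => t t' tt'; rewrite -(gg t) tt' gg.
- by move=> r /mapP[t tS ->] tJ; rewrite gg fJ.
- move=> r rJ rS; have := fS (g * r^-1)%g; rewrite gK; apply.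
  by apply: contra rS => h; apply/mapP; exists (g * r^-1)%g.
Qed.

(** Serves vectors supported on the graph of [h], which embed the space indexed by [I] into the one
    indexed by [J * I]. *)
Lemma sum_graph (I J : finType) (V : nmodType) (h : I -> J) (F : J * I -> V) :
  \sum_p (if p.1 == h p.2 then F p else 0) = \sum_i F (h i, i).
Proof.
transitivity (\sum_p (if p.1 == h p.2 then F (p.1, p.2) else 0)).
  by apply: eq_bigr => -[].
rewrite -(pair_bigA _ (fun j i => if j == h i then F (j, i) else 0)) exchange_big.
apply: eq_bigr => i _; rewrite (bigD1 (h i))//= eqxx big1 ?addr0// => j /negbTE ji.
by rewrite ji.
Qed.

End finite_sums.

Section scalar_mxbound.
Variable R : realType.
Local Notation C := R[i].

Definition scalar_mxbound (K : finType) (b : K -> K -> C) (c : R) : Prop :=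
  mxbound (fun k l (z : C) => b k l * z) c.

Lemma mxopnorm_scalarP (K : finType) (b : K -> K -> C) (c : R) : 0 <= c ->
  (mxopnorm (@enorm R C) (fun k l z => (b k l * z)%R) <= c%:E)%E <->
  scalar_mxbound b c.
Proof.
move=> c0; apply: (@mxopnorm_enormP R C^o) => // i j z x.
by rewrite /GRing.scale/= mulrCA.
Qed.

Lemma mxboundP (V : normedModType C) (K : finType) (T : K -> K -> V -> V) (c : R) :
  0 <= c -> (forall k l z x, T k l (z *: x) = z *: T k l x) ->
  (forall x : K -> V, \sum_k rnorm (x k) ^+ 2 <= 1 ->
     \sum_k rnorm (\sum_l T k l (x l)) ^+ 2 <= c ^+ 2) -> mxbound T c.
Proof.
move=> c0 TZ h; apply/(mxopnorm_enormP c0 TZ)/mxopnorm_leP => //.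
  by move=> z; rewrite lee_fin rnorm_ge0.
by move=> z; rewrite !enorm_sqr !lee_fin; exact: h.
Qed.

Lemma scalar_mxboundP (K : finType) (b : K -> K -> C) (c : R) : 0 <= c ->
  (forall z : K -> C, \sum_k rnorm (z k) ^+ 2 <= 1 ->
     \sum_k rnorm (\sum_l b k l * z l) ^+ 2 <= c ^+ 2) -> scalar_mxbound b c.
Proof.
move=> c0 h; apply: (@mxboundP C^o) => // k l z x.
by rewrite /GRing.scale/= mulrCA.
Qed.

Lemma scalar_mxbound_scale (K : finType) (b : K -> K -> C) (c d : R) : 0 <= d ->
  scalar_mxbound b c -> scalar_mxbound (fun k l => d%:C * b k l) (d * c).
Proof.
move=> d0 h z.
under eq_bigr do under eq_bigr do rewrite -mulrA.
under eq_bigr do rewrite -mulr_sumr rnormM rnorm_real ger0_norm// exprMn.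
by rewrite -mulr_sumr exprMn -(mulrA (d ^+ 2)) ler_wpM2l ?sqr_ge0//; exact: h.
Qed.

(** In an orthonormal basis of the span of the [x l], the matrix acts on each coordinate separately,
    and the scalar bound applies to each. *)
Lemma scalar_mxbound_hilbert (H : hilbertType R) (K : finType) (b : K -> K -> C) c :
  scalar_mxbound b c -> mxbound (fun k l (x : H) => b k l *: x) c.
Proof.
move=> h x.
have [d [e [eon xe]]] := gram_schmidt [seq x l | l <- enum K].
have xE l : x l = \sum_p ip (x l) (e p) *: e p.
  by apply: xe; apply: map_f; rewrite mem_enum.
have E k : \sum_l b k l *: x l = \sum_p (\sum_l b k l * ip (x l) (e p)) *: e p.
  under eq_bigr do rewrite xE scaler_sumr.
  rewrite exchange_big; apply: eq_bigr => p _.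
  by rewrite scaler_suml; apply: eq_bigr => l _; rewrite scalerA.
under eq_bigr do rewrite E parseval//.
under [X in _ <= _ * X]eq_bigr do rewrite xE parseval//.
rewrite exchange_big [X in _ <= _ * X]exchange_big mulr_sumr.
by apply: ler_sum => p _; exact: h.
Qed.

End scalar_mxbound.

Section schur.
Variables (R : realType) (G : groupType).
Local Notation C := R[i].

(** The family [s] may repeat elements. This builds amplification into the definition: on an index
    set [K * 'I_n] the symbol can depend on the first coordinate alone, which is how operator
    entries are reached. *)
Definition schur_bound (v : G -> C) (c : R) : Prop :=
  forall m (s : 'I_m -> G) (b : 'I_m -> 'I_m -> C), scalar_mxbound b 1 ->
    scalar_mxbound (fun k l => v (s k * (s l)^-1)%g * b k l) c.

Lemma schur_bound_fin (v : G -> C) (c d : R) (K : finType) (s : K -> G)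
    (b : K -> K -> C) : schur_bound v c -> 0 < d -> scalar_mxbound b d ->
  scalar_mxbound (fun k l => v (s k * (s l)^-1)%g * b k l) (c * d).
Proof.
move=> vc d0 bd; apply: mxbound_enum.
have b1 : scalar_mxbound (fun k l => (d^-1)%:C * b k l) 1.
  by rewrite -(@mulVf _ d) ?gt_eqF//; apply: scalar_mxbound_scale; rewrite ?invr_ge0 ?ltW.
have b1' : scalar_mxbound (fun k l : 'I_#|K| => (d^-1)%:C * b (enum_val k) (enum_val l)) 1.
  have bij : bijective (@enum_rank K) by exact: enum_rank_bij.
  apply: (mxbound_reindex bij); move: b1; congr mxbound.
  by apply/funext => k; apply/funext => l; apply/funext => z; rewrite !enum_rankK.
have := scalar_mxbound_scale (ltW d0) (vc _ (fun k => s (enum_val k)) _ b1').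
rewrite mulrC; congr mxbound; apply/funext => k; apply/funext => l; apply/funext => z.
congr (_ * _); rewrite mulrCA; congr (_ * _).
by rewrite mulrA -rmorphM /= mulfV ?gt_eqF// mul1r.
Qed.

(* After the substitution g = s k * h the translations no longer depend on k
   (Fell's absorption principle). *)
Lemma fell (V : normedZmodType C) (K : finType) (s : K -> G)
    (T : G -> K -> K -> V -> V) (xi : K -> G -> V) (c a : R) :
  (forall h, mxbound (fun k l => T (s k * h)%g k l) c) ->
  (\sum_l sql2 (xi l) <= a%:E)%E ->
  (\sum_k sql2 (fun g => \sum_l T g k l (translation (s k * (s l)^-1)%g (xi l) g))%R
     <= (c ^+ 2 * a)%:E)%E.
Proof.
move=> Tc xia.
have bij (t : G) : bijective (fun h => t * h)%g.
  by exists (fun h => t^-1 * h)%g => h; rewrite mulgA ?mulVg ?mulgV mul1g.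
under eq_bigr => k _ do rewrite -(sql2_reindex _ (bij (s k))).
apply: sum_sql2_le => J uJ; rewrite exchange_big /=.
apply: (@le_trans _ _ (\sum_(h <- J) c ^+ 2 * \sum_l rnorm (xi l (s l * h)%g) ^+ 2)).
  apply: ler_sum => h _; apply: le_trans (Tc h _).
  rewrite le_eqVlt; apply/orP; left; apply/eqP; apply: eq_bigr => k _.
  congr (rnorm _ ^+ 2); apply: eq_bigr => l _; congr (T _ _ _ _).
  by rewrite /translation invgM invgK -mulgA mulKg.
rewrite -mulr_sumr ler_wpM2l ?sqr_ge0// exchange_big /= -lee_fin.
apply: le_trans xia.
under [leRHS]eq_bigr => l _ do rewrite -(sql2_reindex _ (bij (s l))).
exact: sum_sql2_ge.
Qed.

Lemma group_vN_sum (x : (G -> C) -> G -> C) (J : Type) (s : seq J) (z : J -> C)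
    (xi : J -> G -> C) : group_vN x -> (forall j, l2 (xi j)) ->
  x (fun g => \sum_(j <- s) z j * xi j g) = (fun g => \sum_(j <- s) z j * x (xi j) g).
Proof.
move=> [xlin _ _] lx; elim: s => [|j s ih].
  have E (f : J -> G -> C) : (fun g => \sum_(j <- [::]) z j * f j g) = fun=> 0.
    by apply/funext => g; rewrite big_nil.
  rewrite !E; have l0 := @l2_0 R G.
  have := xlin (-1) _ _ l0 l0.
  under eq_fun do rewrite mulr0 addr0.
  move=> ->; apply/funext => g; by rewrite mulN1r addNr.
have E (f : J -> G -> C) : (fun g => \sum_(j <- j :: s) z j * f j g) =
    fun g => z j * f j g + \sum_(j <- s) z j * f j g.
  by apply/funext => g; rewrite big_cons.
by rewrite !E xlin// ?ih//; exact: l2_sum.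
Qed.

(** Compression to the span of the vectors [delta (sigma q)]. Injectivity of [sigma] makes them
    orthonormal, so the coordinates [Z] and the vectors [xi] have the same norm. *)
Lemma finite_section m (x : 'M[(G -> C) -> (G -> C)]_m) N (sigma : 'I_N -> G) :
  injective sigma -> (forall k l, group_vN (x k l)) -> (l2_mxnorm x <= 1)%E ->
  scalar_mxbound (fun p q : 'I_N * 'I_m => x p.2 q.2 (delta R (sigma q.1)) (sigma p.1)) 1.
Proof.
move=> si xN /(l2_mxnorm_leP _ ler01) x1; apply: scalar_mxboundP => // Z Z1.
pose J := [seq sigma q | q <- enum 'I_N].
have uJ : uniq J by rewrite map_inj_uniq// enum_uniq.
have sumJ (W : nmodType) (f : G -> W) : \sum_(g <- J) f g = \sum_q f (sigma q).
  by rewrite big_map big_enum.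
pose xi l g := \sum_q Z (q, l) * delta R (sigma q) g.
have xis l q : xi l (sigma q) = Z (q, l).
  rewrite /xi (bigD1 q)//= big1 ?addr0 /delta ?eqxx ?mulr1// => q' q'q.
  by rewrite (inj_eq si) eq_sym (negbTE q'q) mulr0.
have xi0 l g : g \notin J -> xi l g = 0.
  move=> gJ; rewrite /xi big1// => q _; rewrite /delta.
  case: eqP => [gq|]; last by rewrite mulr0.
  by move: gJ; rewrite gq map_f// mem_enum.
have nxi : (\sum_l sql2 (xi l) <= 1)%E.
  under eq_bigr => l _ do rewrite (sql2_fsupp uJ (xi0 l)) sumJ.
  rewrite sumEFin lee_fin exchange_big /=.
  rewrite (pair_bigA _ (fun q l => rnorm (xi l (sigma q)) ^+ 2)) /=.
  apply: le_trans Z1; rewrite le_eqVlt; apply/orP; left; apply/eqP.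
  by apply: eq_bigr => -[q l] _ /=; rewrite xis.
have := le_trans (sum_sql2_ge _ uJ) (x1 xi nxi).
rewrite lee_fin; apply: le_trans; rewrite le_eqVlt; apply/orP; left; apply/eqP.
under [RHS]eq_bigr do rewrite sumJ.
rewrite exchange_big /=.
rewrite (pair_bigA _ (fun p k => rnorm ((\sum_l x k l (xi l)) (sigma p)) ^+ 2)) /=.
apply: eq_bigr => -[p k] _ /=; congr (rnorm _ ^+ 2).
transitivity (\sum_q \sum_l x k l (delta R (sigma q)) (sigma p) * Z (q, l)).
  by rewrite pair_bigA; apply: eq_bigr => -[].
rewrite fct_sumE exchange_big; apply: eq_bigr => l _.
rewrite /xi group_vN_sum//; last by move=> q; exact: l2_delta.
by apply: eq_bigr => q _; rewrite mulrC.
Qed.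

End schur.

(** * Herz--Schur norms on the Fourier algebra *)

Section herz_schur_schur.
Variables (R : realType) (G : groupType).
Local Notation C := R[i].

Lemma fourier_mxnorm_le n (u : 'M[G -> C]_n) (c : R) : 0 <= c ->
  (fourier_mxnorm u <= c%:E)%E <->
  (forall m (x : 'M[(G -> C) -> (G -> C)]_m), (forall k l, group_vN (x k l)) ->
     (l2_mxnorm x <= 1)%E ->
     scalar_mxbound (fun p q : 'I_n * 'I_m =>
       fourier_pairing (u p.1 q.1) (x p.2 q.2)) c).
Proof.
move=> c0; split=> [h m x xN x1|h].
  apply/mxopnorm_scalarP => //; apply: le_trans h; apply: ereal_sup_ubound.
  by exists m, x.
apply: ge_ereal_sup => _ [m [x [xN x1 ->]]].
by apply/mxopnorm_scalarP => //; exact: h.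
Qed.

Lemma coefficient_delta (g h t : G) :
  coefficient (delta R g) (delta R h) t = (t == h * g^-1)%g%:R.
Proof.
rewrite coefficient_deltal /delta conjC_nat; congr (nat_of_bool _)%:R.
by apply/eqP/eqP => [<-|->]; rewrite ?mulgK ?mulgVK.
Qed.

Lemma lcomb1E (t : G) (z : C) (xi : G -> C) g :
  lcomb [:: t] (fun=> z) xi g = z * translation t xi g.
Proof. by rewrite /lcomb big_seq1. Qed.

Lemma l2_mxnorm_schur m (s : 'I_m -> G) (b : 'I_m -> 'I_m -> C) :
  scalar_mxbound b 1 ->
  (l2_mxnorm (\matrix_(k, l) lcomb [:: (s k * (s l)^-1)%g] (fun=> b k l)) <= 1)%E.
Proof.
move=> b1; apply/l2_mxnorm_leP => // xi xi1.
have := fell (s := s) (T := fun _ k l z => b k l * z) (fun _ => b1) xi1.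
rewrite mulr1; apply: le_trans; rewrite le_eqVlt; apply/orP; left; apply/eqP.
apply: eq_bigr => k _; congr sql2; apply/funext => g; rewrite fct_sumE.
by apply: eq_bigr => l _; rewrite mxE lcomb1E.
Qed.

(** Multiplication by [v] is tested on the matrix [u] of point masses at [sigma p * (sigma q)^-1].
    Its norm is at most 1 because pairing it with [x] compresses [x] to a finite section. Pairing v
    u with the matrix of b_kl times translation by s_k s_l^-1 gives v(s_k s_l^-1) b_kl at row (tau
    k, k) and column (tau l, l). *)
Lemma schur_bound_herz_schur (v : G -> C) (c : R) : 0 <= c ->
  (herz_schur_norm v <= c%:E)%E -> schur_bound v c.
Proof.
move=> c0 /cb_norm_leP vc m s b b1 z.
(* The [s k] may repeat, while [finite_section] needs an injective enumeration; [tau k] is the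
   position of [s k] in the list without repetitions. *)
pose J := undup [seq s k | k <- enum 'I_m].
have sJ k : s k \in J by rewrite mem_undup map_f// mem_enum.
pose sigma (p : 'I_(size J)) := nth 1%g J p.
have sigma_inj : injective sigma.
  by move=> p q /eqP; rewrite nth_uniq ?undup_uniq// => /eqP/val_inj.
have tauP k : (index (s k) J < size J)%N by rewrite index_mem.
pose tau k := Ordinal (tauP k).
have tauE k : sigma (tau k) = s k by rewrite /sigma nth_index.
pose u : 'M[G -> C]_(size J) :=
  \matrix_(p, q) coefficient (delta R (sigma q)) (delta R (sigma p)).
have uA p q : fourier_algebra (u p q).
  by rewrite mxE; exists (delta R (sigma q)), (delta R (sigma p)); split => //; exact: l2_delta.
have u1 : (fourier_mxnorm u <= 1)%E.
  apply/fourier_mxnorm_le => // m' x xN x1.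
  have := finite_section sigma_inj xN x1.
  congr scalar_mxbound; apply/funext => p; apply/funext => q.
  by rewrite mxE fourier_pairingE ?l2inner_deltar//; exact: l2_delta.
have /(fourier_mxnorm_le _ c0) := vc _ u uA u1.
pose x := \matrix_(k, l) lcomb [:: (s k * (s l)^-1)%g] (fun=> b k l).
have xN k l : group_vN (x k l) by rewrite mxE; exact: lcomb_group_vN.
move=> /(_ _ x xN (l2_mxnorm_schur s b1)).
(* The vector [z] is placed on the graph of [tau], where the entries are the wanted ones; rows off
   the graph are dropped at the end. *)
move=> /(_ (fun q => if q.1 == tau q.2 then z q.2 else 0)).
have -> : \sum_l rnorm (if l.1 == tau l.2 then z l.2 else 0) ^+ 2 =
    \sum_l rnorm (z l) ^+ 2.
  rewrite -(sum_graph tau (fun q => rnorm (z q.2) ^+ 2)).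
  by apply: eq_bigr => q _; case: ifP => // _; rewrite rnorm0 expr0n.
apply: le_trans.
under [leRHS]eq_bigr => p _.
  under eq_bigr => q _.
    rewrite (_ : _ * _ = if q.1 == tau q.2 then
      fourier_pairing (map_mx (fun u s => v s * u s) u p.1 q.1) (x p.2 q.2) * z q.2
      else 0); last by case: ifP => // _; rewrite mulr0.
    over.
  rewrite (sum_graph tau (fun q => fourier_pairing
    (map_mx (fun u s => v s * u s) u p.1 q.1) (x p.2 q.2) * z q.2)) /=.
  over.
pose f p := rnorm (\sum_i fourier_pairing
  (map_mx (fun u s => v s * u s) u p.1 (tau i)) (x p.2 i) * z i) ^+ 2.
rewrite -/(\sum_p f p).
apply: (@le_trans _ _ (\sum_k f (tau k, k))).
  rewrite le_eqVlt; apply/orP; left; apply/eqP; apply: eq_bigr => k _.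
  congr (rnorm _ ^+ 2); apply: eq_bigr => l _ /=; congr (_ * _).
  rewrite !mxE fourier_pairing_lcomb.
    by rewrite big_seq1 coefficient_delta !tauE eqxx mulr1 mulrC.
  apply: (@fourier_algebra_fsupp _ _ [:: (s k * (s l)^-1)%g]) => // t.
  by rewrite inE coefficient_delta !tauE => /negbTE ->; rewrite mulr0.
rewrite -(sum_graph tau f); apply: ler_sum => p _; case: ifP => // _.
exact: sqr_ge0.
Qed.

Section finitely_supported.
Variables (v : G -> C) (S : seq G).
Hypotheses (uS : uniq S) (vS : forall t, t \notin S -> v t = 0).

(** The two entries are pairings of [x] with one and the same function of A(G), the point mass at s
    r^-1; so matrices of elements of VN(G) are constant along s r^-1. *)
Lemma vN_entry (x : (G -> C) -> G -> C) (r s : G) : group_vN x ->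
  x (delta R r) s = x (delta R 1%g) (s * r^-1)%g.
Proof.
move=> xN; rewrite -[LHS]l2inner_deltar -[RHS]l2inner_deltar.
rewrite -(fourier_pairingE xN (l2_delta R r) (l2_delta R s)).
rewrite -(fourier_pairingE xN (l2_delta R 1%g) (l2_delta R (s * r^-1)%g)).
suff -> : coefficient (delta R r) (delta R s) =
  coefficient (delta R 1%g) (delta R (s * r^-1)%g) by [].
by apply/funext => t; rewrite !coefficient_delta invg1 mulg1.
Qed.

Lemma fourier_pairing_fsupp (x : (G -> C) -> G -> C) (w : G -> C) : group_vN x ->
  fourier_pairing (fun t => v t * w t) x =
  \sum_(t <- S) v t * x (delta R 1%g) t * w t.
Proof.
move=> xN; pose eta t := Num.conj (v t * w t).
have eta0 t : t \notin S -> eta t = 0 by move=> /vS; rewrite /eta => ->; rewrite mul0r conjC0.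
have -> : (fun t => v t * w t) = coefficient (delta R 1%g) eta.
  by apply/funext => t; rewrite coefficient_deltal mulg1 conjCK.
rewrite fourier_pairingE//; last 2 first.
- exact: l2_delta.
- exact: l2_fsupp eta0.
rewrite /l2inner (@sum_finite C C^o G S)//.
  by apply: eq_bigr => t _; rewrite conjCK mulrA; congr (_ * _); rewrite mulrC.
by move=> t tS; rewrite eta0// conjC0 mulr0.
Qed.

(** The map on VN(G) dual to multiplication by [v], divided by [c]. By [vN_entry] its finite
    sections are Schur products of the sections of [x] with v(g r^-1). *)
Lemma l2_mxnorm_multiplier m (x : 'M[(G -> C) -> G -> C]_m) (c : R) : 0 < c ->
  schur_bound v c -> (forall k l, group_vN (x k l)) -> (l2_mxnorm x <= 1)%E ->
  (l2_mxnorm (\matrix_(k, l) lcomb S (fun t => (c^-1)%:C * (v t * x k l (delta R 1%g) t))%R)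
    <= 1)%E.
Proof.
move=> c0 vc xN x1; apply/l2_mxnorm_leP => // xi xi1.
apply: sum_sql2_le => J0 uJ0; rewrite expr1n.
(* A value at [g] in [J0] involves the input only at t^-1 g with [t] in [S]; including [J0] as well
   lets one square section carry both input and output. *)
pose J := undup (J0 ++ [seq (t^-1 * g)%g | t <- S, g <- J0]).
have uJ : uniq J by exact: undup_uniq.
pose sigma (p : 'I_(size J)) := nth 1%g J p.
have sigma_inj : injective sigma.
  by move=> p q /eqP; rewrite nth_uniq ?undup_uniq// => /eqP/val_inj.
have sumJ (W : nmodType) (f : G -> W) : \sum_(g <- J) f g = \sum_q f (sigma q).
  by rewrite (big_nth 1%g) big_mkord.
have := schur_bound_fin (fun p : 'I_(size J) * 'I_m => sigma p.1) vc ltr01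
  (finite_section sigma_inj xN x1).
rewrite mulr1 => /(scalar_mxbound_scale (ltW (_ : 0 < c^-1))).
rewrite invr_gt0 mulVf ?gt_eqF// => /(_ c0 (fun q => xi q.2 (sigma q.1))).
have -> : \sum_l rnorm (xi l.2 (sigma l.1)) ^+ 2 =
    \sum_l \sum_(g <- J) rnorm (xi l g) ^+ 2.
  under [RHS]eq_bigr do rewrite sumJ.
  by rewrite [RHS]exchange_big pair_bigA.
move=> h.
apply: (@le_trans _ _ (\sum_l \sum_(g <- J) rnorm (xi l g) ^+ 2)); last first.
  by rewrite -lee_fin; apply: le_trans xi1; exact: sum_sql2_ge.
rewrite expr1n mul1r in h; apply: le_trans h.
pose f k g := rnorm (\sum_l \sum_(r <- J)
  (c^-1)%:C * (v (g * r^-1)%g * x k l (delta R 1%g) (g * r^-1)%g) * xi l r) ^+ 2.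
apply: (@le_trans _ _ (\sum_k \sum_(g <- J) f k g)).
  apply: ler_sum => k _; apply: (@le_trans _ _ (\sum_(g <- J0) f k g)).
    rewrite le_eqVlt; apply/orP; left; apply/eqP.
    rewrite [LHS]big_seq [RHS]big_seq; apply: eq_bigr => g gJ0; rewrite /f fct_sumE.
    congr (rnorm _ ^+ 2); apply: eq_bigr => l _; rewrite mxE /lcomb /translation.
    apply: (@sum_convolution _ _ S J g
      (fun t r => (c^-1)%:C * (v t * x k l (delta R 1%g) t) * xi l r)) => //.
      by move=> t /vS ->; rewrite !(mul0r, mulr0).
    move=> t tS; rewrite mem_undup mem_cat negb_or => /andP[_ /negP[]].
    by apply/allpairsP; exists (t, g).
  apply: ler_sum_sub => //; last by move=> g; exact: sqr_ge0.
  by move=> g gJ0; rewrite mem_undup mem_cat gJ0.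
under eq_bigr do rewrite sumJ.
rewrite exchange_big pair_bigA /= le_eqVlt; apply/orP; left; apply/eqP.
apply: eq_bigr => -[p k] _ /=; rewrite /f; congr (rnorm _ ^+ 2).
under [LHS]eq_bigr do rewrite sumJ.
rewrite [LHS]exchange_big [LHS]pair_bigA /=. apply: eq_bigr => -[q l] _ /=.
by rewrite (vN_entry (sigma q) (sigma p) (xN k l)).
Qed.

(** The pairing of v u with [x] equals [c] times the pairing of u with the contraction of
    [l2_mxnorm_multiplier], so the bound passes from VN(G) to its predual. Finite support also puts
    v u in A(G) at once. *)
Lemma herz_schur_schur_bound (c : R) : 0 < c -> schur_bound v c ->
  herz_schur v /\ (herz_schur_norm v <= c%:E)%E.
Proof.
move=> c0 vc; have hc : (herz_schur_norm v <= c%:E)%E.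
  apply/cb_norm_leP => n u uA /(fourier_mxnorm_le _ ler01) u1.
  apply/fourier_mxnorm_le => [|m x xN x1]; first exact: ltW.
  have y1 := l2_mxnorm_multiplier c0 vc xN x1.
  have := u1 _ _ _ y1; set y := (\matrix_(_, _) _).
  have yN k l : group_vN (y k l) by rewrite mxE; exact: lcomb_group_vN.
  move=> /(_ yN) /(scalar_mxbound_scale (ltW c0)); rewrite mulr1.
  congr scalar_mxbound; apply/funext => p; apply/funext => q.
  rewrite !mxE fourier_pairing_fsupp// fourier_pairing_lcomb// mulr_sumr.
  apply: eq_bigr => t _; rewrite !mulrA -rmorphM /= mulfV ?gt_eqF// mul1r.
  by congr (_ * _); rewrite mulrC.
split=> //; split; last exact: le_lt_trans hc (ltry _).
by move=> u _; apply: (fourier_algebra_fsupp uS) => t /vS ->; rewrite mul0r.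
Qed.

End finitely_supported.
End herz_schur_schur.

(** * Representations and crossed products *)

Section cnorm_theory.
Variables (R : realType) (A : cstarAlgType R).
Implicit Types a b : A.

Lemma cnorm0 : cnorm (0 : A) = 0.
Proof. by rewrite -[0 : A](scale0r (0 : A)) cnormZ rnorm0 mul0r. Qed.

Lemma cnormN a : cnorm (- a) = cnorm a.
Proof. by rewrite -scaleN1r cnormZ rnormN rnorm1 mul1r. Qed.

Lemma cnorm_ge0 a : 0 <= cnorm a.
Proof. by have := ler_cnormD a (- a); rewrite subrr cnorm0 cnormN; lra. Qed.

Lemma cnorm_realZ (r : R) a : 0 <= r -> cnorm (r%:C *: a) = r * cnorm a.
Proof. by move=> r0; rewrite cnormZ rnorm_real ger0_norm. Qed.

Lemma star1 : star (1 : A) = 1.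
Proof. by rewrite -[LHS]mulr1 -{2}[1](@starK _ A) -starM mulr1 starK. Qed.

End cnorm_theory.

Section crossed_products.
Variables (R : realType) (A : cstarAlgType R) (H : hilbertType R).
Variables (rho : A -> H -> H) (G : groupType) (alpha : G -> {lrmorphism A -> A}).
Hypotheses (hrho : is_faithful_rep rho) (halpha : is_action alpha).
Local Notation C := R[i].

Lemma repDr a x y : rho a (x + y) = rho a x + rho a y.
Proof. by have := rep_linear hrho a 1 x y; rewrite !scale1r. Qed.

Lemma rep0r a : rho a 0 = 0.
Proof. by have := rep_linear hrho a (-1) 0 0; rewrite scaler0 addr0 scaleN1r addNr. Qed.

Lemma repZr a c x : rho a (c *: x) = c *: rho a x.
Proof. by have := rep_linear hrho a c x 0; rewrite !addr0 rep0r addr0. Qed.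

Lemma rep_sumr a (I : Type) (s : seq I) (P : pred I) (x : I -> H) :
  rho a (\sum_(i <- s | P i) x i) = \sum_(i <- s | P i) rho a (x i).
Proof. by rewrite (big_morph (rho a) (repDr a) (rep0r a)). Qed.

Lemma repDl a b x : rho (a + b) x = rho a x + rho b x.
Proof. by have := repDZ hrho 1 a b x; rewrite !scale1r. Qed.

Lemma rep0l x : rho 0 x = 0.
Proof. by have := repDZ hrho (-1) 0 0 x; rewrite scaler0 addr0 scaleN1r addNr. Qed.

Lemma repZl c a x : rho (c *: a) x = c *: rho a x.
Proof. by have := repDZ hrho c a 0 x; rewrite !addr0 rep0l addr0. Qed.

Lemma repNl a x : rho (- a) x = - rho a x.
Proof. by rewrite -scaleN1r repZl scaleN1r. Qed.

Lemma ip_rep_star a x y : ip (rho (star a) x) y = ip x (rho a y).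
Proof. exact: rep_star. Qed.

(** [alpha 1] is idempotent by [actionM], and it is injective. *)
Lemma alpha1 a : alpha 1%g a = a.
Proof.
apply: (bij_inj (action_bij halpha 1%g)).
by rewrite -(actionM halpha) mulg1.
Qed.

Lemma rep_mxnormP n (a : 'M[A]_n) (c : R) : 0 <= c ->
  (rep_mxnorm rho a <= c%:E)%E <-> mxbound (fun i j => rho (a i j)) c.
Proof.
move=> c0; apply: mxopnorm_enormP => // i j z x; exact: repZr.
Qed.

Lemma cbnormA_fin (phi : A -> A) (d : R) (K : finType) (a : K -> K -> A) : 0 <= d ->
  (cbnormA rho phi <= d%:E)%E -> mxbound (fun k l => rho (a k l)) 1 ->
  mxbound (fun k l => rho (phi (a k l))) d.
Proof.
move=> d0 /cb_norm_leP h a1; apply: mxbound_enum.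
pose a' : 'M[A]_#|K| := \matrix_(k, l) a (enum_val k) (enum_val l).
have /h : forall i j, [set: A] (a' i j) by [].
have a'1 : (rep_mxnorm rho a' <= 1)%E.
  apply/rep_mxnormP => //; have bij : bijective (@enum_rank K) by exact: enum_rank_bij.
  apply: (mxbound_reindex bij); move: a1; congr mxbound.
  by apply/funext => k; apply/funext => l; apply/funext => z; rewrite mxE !enum_rankK.
move=> /(_ a'1)/(rep_mxnormP _ d0); congr mxbound.
by apply/funext => k; apply/funext => l; rewrite !mxE.
Qed.

(** The substitution t = g r^-1 exhibits the kernel of the operator. The disjunction lets finiteness
    come either from the function [f] or from the vector [xi]; both cases occur. *)
Lemma integrated_formE (f : G -> A) (xi : G -> H) (J : seq G) (g : G) : uniq J ->
  (forall r, r \notin J -> f (g * r^-1)%g = 0 \/ xi r = 0) ->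
  integrated_form rho alpha f xi g =
  \sum_(r <- J) rho (alpha g^-1%g (f (g * r^-1)%g)) (xi r).
Proof.
move=> uJ J0.
have gg t : (g * (t^-1 * g)^-1)%g = t by rewrite invgM invgK mulgA mulgV mul1g.
have gK r : ((g * r^-1)^-1 * g)%g = r by rewrite invgM invgK mulgVK.
rewrite /integrated_form /crossed_pi /translation.
rewrite (@sum_finite _ _ _ [seq (g * r^-1)%g | r <- J]).
- by rewrite big_map; apply: eq_bigr => r _; rewrite gK.
- by rewrite map_inj_uniq// => r r' rr'; rewrite -(gK r) rr' gK.
- move=> t tJ; have : (t^-1 * g)%g \notin J.
    by apply: contra tJ => h; apply/mapP; exists (t^-1 * g)%g; rewrite ?gg.
  by move=> /J0; rewrite gg => -[->|->]; rewrite ?raddf0 ?rep0l ?rep0r.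
Qed.

Lemma l1_fsupp (s : seq G) (f : G -> A) : uniq s ->
  (forall t, t \notin s -> f t = 0) -> l1 f.
Proof.
move=> us f0.
have E : (\esum_(i in [set: G]) (cnorm (f i))%:E =
    \esum_(i in [set` s]) (cnorm (f i))%:E)%E.
  rewrite [RHS]esum_mkcond; apply: eq_esum => i _; case: ifPn => //.
  by rewrite notin_setE /= => /negP ins; rewrite f0// cnorm0.
change ((\esum_(i in [set: G]) (cnorm (f i))%:E < +oo)%E).
rewrite E esum_fset; [|exact: finite_seq|by move=> i _; rewrite lee_fin cnorm_ge0].
by rewrite -fsbig_seq// sumEFin ltry.
Qed.

(** [mult_map] chooses a preimage under [integrated_form]; injectivity makes the choice harmless,
    and the norm can be tested on matrices of l^1 functions. *)
Lemma hs_norm_le (F : G -> {linear A -> A}) (c : \bar R) :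
  (hs_norm rho alpha F <= c)%E <->
  (forall n (f : 'I_n -> 'I_n -> G -> A), (forall i j, l1 (f i j)) ->
    (l2_mxnorm (\matrix_(i, j) integrated_form rho alpha (f i j)) <= 1)%E ->
    (l2_mxnorm (\matrix_(i, j) integrated_form rho alpha (mult_by F (f i j))) <= c)%E).
Proof.
split=> [/cb_norm_leP h n f f1 x1|h].
  have := h n (\matrix_(i, j) integrated_form rho alpha (f i j)).
  have -> : map_mx (mult_map rho alpha F)
      (\matrix_(i, j) integrated_form rho alpha (f i j)) =
      \matrix_(i, j) integrated_form rho alpha (mult_by F (f i j)).
    by apply/matrixP => i j; rewrite !mxE mult_mapE.
  by apply => // i j; rewrite mxE; exists (f i j).
apply/cb_norm_leP => n a Da a1.
have /choice[f fP] : forall i, exists fi : 'I_n -> G -> A, forall j,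
    l1 (fi j) /\ integrated_form rho alpha (fi j) = a i j.
  move=> i; have /choice[fi fiP] : forall j, exists fij,
      l1 fij /\ integrated_form rho alpha fij = a i j.
    by move=> j; have [fij] := Da i j; exists fij.
  by exists fi.
have aE : a = \matrix_(i, j) integrated_form rho alpha (f i j).
  by apply/matrixP => i j; rewrite mxE; have [] := fP i j.
have -> : map_mx (mult_map rho alpha F) a =
    \matrix_(i, j) integrated_form rho alpha (mult_by F (f i j)).
  by apply/matrixP => i j; rewrite aE !mxE mult_mapE//; have [] := fP i j.
by apply: h => [i j|]; [have [] := fP i j|rewrite -aE].
Qed.

(** In a finite orthonormal family [e] the operators become a scalar matrix [b] over [K * 'I_n],
    bounded by [d] thanks to Bessel. The symbol ignores the second index, so [schur_bound] applies
    to [b] as it stands. *)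
Lemma mxbound_hilbert (K : finType) (s : K -> G) (v : G -> C) (c d : R)
    (T : K -> K -> H -> H) : schur_bound v c -> 0 < d ->
  (forall k l x y, T k l (x + y) = T k l x + T k l y) ->
  (forall k l z x, T k l (z *: x) = z *: T k l x) ->
  mxbound T d -> mxbound (fun k l x => v (s k * (s l)^-1)%g *: T k l x) (c * d).
Proof.
move=> vc d0 TD TZ Td x.
have T0 k l : T k l 0 = 0 by rewrite -[0](scale0r 0) TZ !scale0r.
pose y k := \sum_l v (s k * (s l)^-1)%g *: T k l (x l).
(* The images [y k] join the list, so that Parseval is exact on the left side too. *)
have [n [e [eon he]]] := gram_schmidt
  ([seq x l | l <- enum K] ++ [seq y k | k <- enum K]).
have xE l : x l = \sum_p ip (x l) (e p) *: e p.
  by apply: he; rewrite mem_cat map_f// mem_enum.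
have yE k : y k = \sum_p ip (y k) (e p) *: e p.
  by apply: he; rewrite mem_cat [X in _ || X]map_f ?orbT// mem_enum.
pose b (p q : K * 'I_n) := ip (T p.1 q.1 (e q.2)) (e p.2).
have TE k l (z : 'I_n -> C) : T k l (\sum_q z q *: e q) = \sum_q z q *: T k l (e q).
  rewrite (big_morph (T k l) (TD k l) (T0 k l)).
  by apply: eq_bigr => q _; rewrite TZ.
have bd : scalar_mxbound b d.
  move=> z; pose w l := \sum_q z (l, q) *: e q.
  have nw : \sum_l rnorm (w l) ^+ 2 = \sum_p rnorm (z p) ^+ 2.
    under eq_bigr do rewrite parseval//.
    by rewrite pair_bigA; apply: eq_bigr => -[].
  rewrite -nw; apply: le_trans (Td w).
  rewrite -(pair_bigA _ (fun k p => rnorm (\sum_q b (k, p) q * z q) ^+ 2)) /=.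
  apply: ler_sum => k _; apply: le_trans (bessel eon _).
  rewrite le_eqVlt; apply/orP; left; apply/eqP; apply: eq_bigr => p _.
  congr (rnorm _ ^+ 2); rewrite inner_suml.
  transitivity (\sum_l \sum_q b (k, p) (l, q) * z (l, q)).
    by rewrite pair_bigA; apply: eq_bigr => -[].
  apply: eq_bigr => l _; rewrite TE inner_suml; apply: eq_bigr => q _.
  by rewrite innerZl mulrC.
have := schur_bound_fin (fun p : K * 'I_n => s p.1) vc d0 bd (fun q => ip (x q.1) (e q.2)).
have -> : \sum_l rnorm (ip (x l.1) (e l.2)) ^+ 2 = \sum_l rnorm (x l) ^+ 2.
  rewrite -(pair_bigA _ (fun l q => rnorm (ip (x l) (e q)) ^+ 2)) /=.
  by apply: eq_bigr => l _; rewrite [in RHS]xE parseval.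
apply: le_trans; under eq_bigr => k _ do rewrite -/(y k) yE parseval//.
rewrite pair_bigA le_eqVlt; apply/orP; left; apply/eqP; apply: eq_bigr => -[k p] _ /=.
congr (rnorm _ ^+ 2); rewrite {1}/y inner_suml.
rewrite (_ : \sum_l v _ * _ * _ = \sum_l \sum_q v (s k * (s l)^-1)%g *
  b (k, p) (l, q) * ip (x l) (e q)); last by rewrite pair_bigA; apply: eq_bigr => -[].
apply: eq_bigr => l _; rewrite innerZl [in LHS]xE TE inner_suml mulr_sumr.
by apply: eq_bigr => q _; rewrite innerZl -mulrA; congr (_ * _); rewrite mulrC.
Qed.

End crossed_products.

(** * Bounds on multipliers of crossed products *)

Section hs_norm_bounds.
Variables (R : realType) (A : cstarAlgType R) (H : hilbertType R).
Variables (rho : A -> H -> H) (G : groupType) (alpha : G -> {lrmorphism A -> A}).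
Hypotheses (hrho : is_faithful_rep rho) (halpha : is_action alpha).
Local Notation C := R[i].

Lemma integrated_form_section n (f : 'I_n -> 'I_n -> G -> A) N (sigma : 'I_N -> G) :
  injective sigma ->
  (l2_mxnorm (\matrix_(i, j) integrated_form rho alpha (f i j)) <= 1)%E ->
  mxbound (fun p q : 'I_N * 'I_n => rho (alpha (sigma p.1)^-1%g
    (f p.2 q.2 (sigma p.1 * (sigma q.1)^-1)%g))) 1.
Proof.
move=> si /(l2_mxnorm_leP _ ler01) x1; apply: mxboundP => //.
  by move=> *; exact: repZr.
move=> Z Z1.
pose J := [seq sigma q | q <- enum 'I_N].
have uJ : uniq J by rewrite map_inj_uniq// enum_uniq.
have sumJ (W : nmodType) (w : G -> W) : \sum_(g <- J) w g = \sum_q w (sigma q).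
  by rewrite big_map big_enum.
pose xi l g := \sum_q (if g == sigma q then Z (q, l) else 0).
have xis l q : xi l (sigma q) = Z (q, l).
  rewrite /xi (bigD1 q)//= big1 ?addr0 ?eqxx// => q' q'q.
  by rewrite (inj_eq si) eq_sym (negbTE q'q).
have xi0 l g : g \notin J -> xi l g = 0.
  move=> gJ; rewrite /xi big1// => q _; case: eqP => // gq.
  by move: gJ; rewrite gq map_f// mem_enum.
have nxi : (\sum_l sql2 (xi l) <= 1)%E.
  under eq_bigr => l _ do rewrite (sql2_fsupp uJ (xi0 l)) sumJ.
  rewrite sumEFin lee_fin exchange_big /=.
  rewrite (pair_bigA _ (fun q l => rnorm (xi l (sigma q)) ^+ 2)) /=.
  apply: le_trans Z1; rewrite le_eqVlt; apply/orP; left; apply/eqP.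
  by apply: eq_bigr => -[q l] _ /=; rewrite xis.
have := le_trans (sum_sql2_ge _ uJ) (x1 xi nxi).
rewrite lee_fin; apply: le_trans; rewrite le_eqVlt; apply/orP; left; apply/eqP.
under [RHS]eq_bigr do rewrite sumJ.
rewrite [RHS]exchange_big [RHS]pair_bigA /=.
apply: eq_bigr => -[p k] _ /=; congr (rnorm _ ^+ 2).
transitivity (\sum_q \sum_l rho (alpha (sigma p)^-1%g
    (f k l (sigma p * (sigma q)^-1)%g)) (Z (q, l))).
  by rewrite pair_bigA; apply: eq_bigr => -[].
rewrite fct_sumE exchange_big; apply: eq_bigr => l _.
rewrite mxE (integrated_formE alpha hrho (J := J))//.
  by rewrite sumJ; apply: eq_bigr => q _; rewrite xis.
by move=> r /(xi0 l); right.
Qed.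

(** The new kernel has entries alpha_{g^-1}(v(g r^-1) phi(f(g r^-1))). Equivariance moves [phi]
    outside alpha_{g^-1}: the section arises from the old one by applying [phi] entrywise, at cost
    [d], and then the Schur multiplier [v], at cost [c]. *)
Lemma hs_norm_scale (v : G -> C) (S : seq G) (phi : A -> A)
    (F : G -> {linear A -> A}) (c d : R) : uniq S ->
  (forall t, t \notin S -> v t = 0) -> 0 <= c -> 0 < d -> schur_bound v c ->
  (cbnormA rho phi <= d%:E)%E ->
  (forall t a, phi (alpha t a) = alpha t (phi a)) ->
  (forall t a, F t a = v t *: phi a) ->
  (hs_norm rho alpha F <= (c * d)%:E)%E.
Proof.
move=> uS vS c0 d0 vc phid phia FE.
apply/(hs_norm_le hrho halpha) => n f fl1 x1.
apply/l2_mxnorm_leP => [|xi xi1]; first by rewrite mulr_ge0// ltW.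
apply: sum_sql2_le => J0 uJ0.
pose J := undup (J0 ++ [seq (t^-1 * g)%g | t <- S, g <- J0]).
have uJ : uniq J by exact: undup_uniq.
pose sigma (p : 'I_(size J)) := nth 1%g J p.
have sigma_inj : injective sigma.
  by move=> p q /eqP; rewrite nth_uniq ?undup_uniq// => /eqP/val_inj.
have sumJ (W : nmodType) (w : G -> W) : \sum_(g <- J) w g = \sum_q w (sigma q).
  by rewrite (big_nth 1%g) big_mkord.
have T1 := cbnormA_fin hrho (ltW d0) phid (integrated_form_section sigma_inj x1).
have := mxbound_hilbert (fun p : 'I_(size J) * 'I_n => sigma p.1) vc d0
  (fun _ _ => repDr hrho _) (fun _ _ => repZr hrho _) T1.
move=> /(_ (fun q => xi q.2 (sigma q.1))).
have -> : \sum_l rnorm (xi l.2 (sigma l.1)) ^+ 2 =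
    \sum_l \sum_(g <- J) rnorm (xi l g) ^+ 2.
  under [RHS]eq_bigr do rewrite sumJ.
  by rewrite [RHS]exchange_big pair_bigA.
move=> h.
apply: (@le_trans _ _ ((c * d) ^+ 2 *
    \sum_l \sum_(g <- J) rnorm (xi l g) ^+ 2)); last first.
  rewrite ler_piMr ?sqr_ge0// -lee_fin; apply: le_trans xi1; exact: sum_sql2_ge.
apply: le_trans h.
pose h k g := rnorm (\sum_l \sum_(r <- J)
  v (g * r^-1)%g *: rho (phi (alpha g^-1%g (f k l (g * r^-1)%g))) (xi l r)) ^+ 2.
apply: (@le_trans _ _ (\sum_k \sum_(g <- J) h k g)).
  apply: ler_sum => k _; apply: (@le_trans _ _ (\sum_(g <- J0) h k g)).
    rewrite le_eqVlt; apply/orP; left; apply/eqP.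
    rewrite [LHS]big_seq [RHS]big_seq; apply: eq_bigr => g gJ0; rewrite /h fct_sumE.
    congr (rnorm _ ^+ 2); apply: eq_bigr => l _; rewrite mxE.
    rewrite (integrated_formE alpha hrho (J := J))//.
      by apply: eq_bigr => r _; rewrite /mult_by FE phia linearZ /= repZl.
    move=> r rJ; left; rewrite /mult_by FE vS ?scale0r//.
    apply: contra rJ => grS; rewrite mem_undup mem_cat; apply/orP; right.
    apply/allpairsP; exists ((g * r^-1)%g, g); split => //=.
    by rewrite invgM invgK mulgVK.
  apply: ler_sum_sub => //; last by move=> g; exact: sqr_ge0.
  by move=> g gJ0; rewrite mem_undup mem_cat gJ0.
under eq_bigr do rewrite sumJ.
rewrite exchange_big pair_bigA /= le_eqVlt; apply/orP; left; apply/eqP.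
apply: eq_bigr => -[p k] _ /=; rewrite /h; congr (rnorm _ ^+ 2).
under [LHS]eq_bigr do rewrite sumJ.
by rewrite [LHS]exchange_big [LHS]pair_bigA.
Qed.

Definition single (t0 : G) (a : A) : G -> A := fun t => if t == t0 then a else 0.

Lemma l1_single t0 a : l1 (single t0 a).
Proof.
apply: (@l1_fsupp _ _ _ [:: t0]) => // t.
by rewrite inE /single => /negbTE ->.
Qed.

Lemma integrated_form_single t0 a xi g :
  integrated_form rho alpha (single t0 a) xi g =
  rho (alpha g^-1%g a) (translation t0 xi g).
Proof.
rewrite (integrated_formE alpha hrho (J := [:: (t0^-1 * g)%g]))// => [|r].
  by rewrite big_seq1 /single invgM invgK mulgA mulgV mul1g eqxx.
rewrite inE /single => rt; left; case: eqP => // gr.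
by move: rt; rewrite -gr invgM invgK mulgVK eqxx.
Qed.

Lemma mult_by_single (F : G -> {linear A -> A}) t0 a :
  mult_by F (single t0 a) = single t0 (F t0 a).
Proof.
by apply/funext => t; rewrite /mult_by /single; case: eqP => [->//|_]; rewrite raddf0.
Qed.

(** [rho] may be degenerate, so [rho 1] is a self-adjoint idempotent and not always the identity;
    Pythagoras splits [x] along it. *)
Lemma rep1_contr x : rnorm (rho 1 x) <= rnorm x.
Proof.
rewrite -(@ler_pXn2r _ 2) ?nnegrE ?rnorm_ge0//.
have -> : rnorm x ^+ 2 = rnorm (rho 1 x) ^+ 2 + rnorm (x - rho 1 x) ^+ 2.
  rewrite -pythagoras ?[_ + (_ - _)]addrC ?subrK//.
  have -> : ip (rho 1 x) (x - rho 1 x) = ip (rho 1 x) x - ip (rho 1 x) (rho 1 x).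
    by rewrite innerDr innerNr.
  by rewrite -[X in _ - X](ip_rep_star hrho) star1 -(repM hrho) mul1r subrr.
by rewrite lerDl sqr_ge0.
Qed.

Lemma hs_norm_schur_bound (F : G -> {linear A -> A}) (c : R) (x0 : H) : 0 <= c ->
  (hs_norm rho alpha F <= c%:E)%E ->
  (forall r t a, F t (alpha r a) = alpha r (F t a)) -> rnorm x0 = 1 ->
  schur_bound (fun t => ip (rho (F t 1) x0) x0) c.
Proof.
move=> c0 /(hs_norm_le hrho halpha) Fc Fa x01 m s b b1.
have := Fc m (fun k l => single (s k * (s l)^-1)%g (b k l *: 1)).
move=> /(_ (fun k l => l1_single _ _)).
have -> : (l2_mxnorm (\matrix_(i, j) integrated_form rho alpha
    (single (s i * (s j)^-1)%g (b i j *: 1%R))) <= 1)%E.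
  apply/l2_mxnorm_leP => // xi xi1.
  have T1 : mxbound (fun k l x => b k l *: rho 1 x) 1.
    move=> x; apply: le_trans (scalar_mxbound_hilbert b1 (fun l => rho 1 (x l))) _.
    rewrite ler_wpM2l ?sqr_ge0//; apply: ler_sum => l _.
    by rewrite ler_pXn2r ?nnegrE ?rnorm_ge0// rep1_contr.
  have := fell (s := s) (T := fun _ k l x => b k l *: rho 1 x) (fun _ => T1) xi1.
  rewrite mulr1; apply: le_trans; rewrite le_eqVlt; apply/orP; left; apply/eqP.
  apply: eq_bigr => k _; congr sql2; apply/funext => g; rewrite fct_sumE.
  apply: eq_bigr => l _; rewrite mxE integrated_form_single.
  by rewrite linearZ /= rmorph1 repZl.
move=> /(_ isT)/(l2_mxnorm_leP _ c0) h; apply: scalar_mxboundP => // z z1.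
(* At [s k], translation by s_k s_l^-1 reads [xi l] at [s l]. Row [k] of the image thus has there
   the value sum_l b_kl z_l F(s_k s_l^-1)(1) x0, where invariance has removed alpha. *)
pose xi l g := if g == s l then z l *: x0 else 0.
have xi1 : (\sum_l sql2 (xi l) <= 1)%E.
  under eq_bigr => l _.
    rewrite (sql2_fsupp (s := [:: s l]))//; last first.
      by move=> g; rewrite inE /xi => /negbTE ->.
    rewrite big_seq1 /xi eqxx rnormZ x01 mulr1; over.
  by rewrite sumEFin lee_fin.
rewrite -lee_fin; apply: le_trans (h xi xi1); rewrite -sumEFin; apply: lee_sum => k _.
set eta := (X in (_ <= sql2 X)%E).
(* Of row [k] only the value at [s k] is kept, and of that only the component along [x0]. *)
apply: (@le_trans _ _ (rnorm (eta (s k)) ^+ 2)%:E); last first.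
  have := sum_sql2_ge (fun _ : 'I_1 => eta) (s := [:: s k]) isT.
  by rewrite !big_ord1 big_seq1.
rewrite lee_fin ler_pXn2r ?nnegrE ?rnorm_ge0//.
apply: le_trans (rnorm_inner_le _ x01).
rewrite le_eqVlt; apply/orP; left; apply/eqP; congr rnorm.
rewrite /eta fct_sumE inner_suml; apply: eq_bigr => l _.
rewrite mxE mult_by_single integrated_form_single linearZ /= linearZ /=.
rewrite -Fa rmorph1 repZl// /translation invgM invgK -mulgA mulVg mulg1 /xi eqxx.
by rewrite repZr// !innerZl mulrA -[LHS]mulrA [LHS]mulrC.
Qed.

End hs_norm_bounds.

(** * Square roots in C*-algebras *)

Section square_root.
Variables (R : realType) (A : cstarAlgType R).
Local Notation C := R[i].
Implicit Types a b w x : A.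

Lemma cnorm_eq0_le a : cnorm a <= 0 -> a = 0.
Proof.
by move=> a0; apply: cnorm_eq0; apply/eqP; rewrite eq_le a0 cnorm_ge0.
Qed.

Lemma ler_cnormB a b : cnorm (a - b) <= cnorm a + cnorm b.
Proof. by rewrite -(cnormN b) ler_cnormD. Qed.

Lemma cnorm_small a (K : R) : (forall e, 0 < e -> cnorm a <= K * e) -> a = 0.
Proof.
move=> h; apply: cnorm_eq0_le; apply/ler_addgt0Pr => e e0; rewrite add0r.
have K0 : 0 < `|K| + 1 by rewrite ltr_wpDl.
apply: le_trans (h _ (divr_gt0 e0 K0)) _.
rewrite mulrCA ler_piMr ?(ltW e0)// ler_pdivrMr// mul1r.
by apply: le_trans (ler_norm K) _; rewrite lerDl.
Qed.

Lemma starB a b : star (a - b) = star a - star b.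
Proof.
rewrite starD -scaleN1r starZ (_ : Num.conj (-1) = -1 :> C) ?scaleN1r//.
by rewrite conj_Creal.
Qed.

Lemma star0 : star (0 : A) = 0.
Proof. by rewrite -{1}(subrr 0) starB subrr. Qed.

Lemma star_realZ (r : R) a : star (r%:C *: a) = r%:C *: star a.
Proof. by rewrite starZ conj_Creal// complex_real. Qed.

Lemma cnorm_star a : cnorm (star a) = cnorm a.
Proof.
have h b : cnorm b <= cnorm (star b).
  have := ler_cnormM (star b) b; rewrite cstar_identity expr2.
  have [b0|b0] := eqVneq (cnorm b) 0; first by rewrite b0 cnorm_ge0.
  by rewrite ler_pM2r// lt_neqAle eq_sym b0 cnorm_ge0.
by apply/eqP; rewrite eq_le h andbT -{2}(@starK _ A a) h.
Qed.

Lemma cnorm1 : cnorm (1 : A) = 1.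
Proof.
have := @cstar_identity _ A 1; rewrite star1 mulr1 => h.
have c0 : cnorm (1 : A) != 0.
  by apply: contraNneq (oner_neq0 A) => /(@cnorm_eq0 _ A) ->.
by apply: (mulfI c0); rewrite -expr2 -h mulr1.
Qed.

Section iteration.
Variable w : A.
Hypotheses (ws : star w = w) (w1 : cnorm w <= 1).

(* Iterates of p |-> (w + p ^ 2) / 2, whose fixed point s satisfies
   (1 - s) ^ 2 = 1 - w; sqrt_bound runs the same recursion on norms. *)
Fixpoint sqrt_iter n : A :=
  if n is n'.+1 then (2^-1)%:C *: (w + sqrt_iter n' * sqrt_iter n') else 0.

Fixpoint sqrt_bound n : R :=
  if n is n'.+1 then 2^-1 * (1 + sqrt_bound n' * sqrt_bound n') else 0.

Local Notation p := sqrt_iter.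
Local Notation t := sqrt_bound.

Lemma sqrt_bound_itv n : 0 <= t n <= 1.
Proof. by elim: n => [|n /andP[h0 h1]] /=; [rewrite lexx ler01|nra]. Qed.

Lemma cnorm_sqrt_iter n : cnorm (p n) <= t n.
Proof.
elim: n => [|n ih] /=; first by rewrite cnorm0.
rewrite cnorm_realZ ?invr_ge0// ler_wpM2l ?invr_ge0//.
apply: le_trans (ler_cnormD _ _) _; apply: lerD => //.
apply: le_trans (ler_cnormM _ _) _.
by rewrite ler_pM ?cnorm_ge0.
Qed.

Lemma sqrt_iter_star n : star (p n) = p n.
Proof.
by elim: n => [|n ih] /=; rewrite ?star0// star_realZ starD starM ih ws.
Qed.

Lemma sqrt_iter_comm a n : a * w = w * a -> a * p n = p n * a.
Proof.
move=> aw; elim: n => [|n ih] /=; first by rewrite mulr0 mul0r.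
by rewrite -scalerAr -scalerAl mulrDr mulrDl aw mulrA ih -mulrA ih mulrA.
Qed.

Lemma subr_sqrE a b : a * a - b * b = a * (a - b) + (a - b) * b.
Proof. by rewrite mulrBr mulrBl addrA subrK. Qed.

Lemma cnorm_subr_sqr a b (M e : R) : cnorm a <= M -> cnorm b <= M ->
  cnorm (a - b) <= e -> cnorm (a * a - b * b) <= 2 * M * e.
Proof.
move=> aM bM abe; rewrite subr_sqrE; apply: le_trans (ler_cnormD _ _) _.
have := ler_cnormM a (a - b); have := ler_cnormM (a - b) b.
have := cnorm_ge0 a; have := cnorm_ge0 b; have := cnorm_ge0 (a - b).
nra.
Qed.

(** [subr_sqrE] factors a difference of squares without commutation, and the scalar recursion
    factors in the same way, so its increments dominate. *)
Lemma cnorm_sqrt_iterB n : cnorm (p n.+1 - p n) <= t n.+1 - t n.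
Proof.
elim: n => [|n ih].
  have := cnorm_sqrt_iter 1; by rewrite [p 0]/= [t 0]/= !subr0.
have -> : p n.+2 - p n.+1 = (2^-1)%:C *: (p n.+1 * p n.+1 - p n * p n).
  transitivity ((2^-1)%:C *: (w + p n.+1 * p n.+1) - (2^-1)%:C *: (w + p n * p n)) => //.
  rewrite -scalerBr; congr (_ *: _).
  by rewrite opprD addrACA subrr add0r.
have -> : t n.+2 - t n.+1 = 2^-1 * (t n.+1 * (t n.+1 - t n) + (t n.+1 - t n) * t n).
  transitivity (2^-1 * (1 + t n.+1 * t n.+1) - 2^-1 * (1 + t n * t n)) => //.
  by move: (t n.+1) (t n) => x y; ring.
rewrite cnorm_realZ ?invr_ge0// ler_wpM2l ?invr_ge0// subr_sqrE.
apply: le_trans (ler_cnormD _ _) _; apply: lerD; apply: le_trans (ler_cnormM _ _) _;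
  by rewrite ler_pM ?cnorm_ge0// cnorm_sqrt_iter.
Qed.

Lemma cnorm_sqrt_iterB_le m n : (n <= m)%N -> cnorm (p m - p n) <= t m - t n.
Proof.
move=> /subnK <-; elim: (m - n)%N => [|k ih]; first by rewrite add0n !subrr cnorm0.
have -> : p (k.+1 + n) - p n = (p (k + n).+1 - p (k + n)) + (p (k + n) - p n).
  by rewrite addrA subrK.
apply: le_trans (ler_cnormD _ _) _.
by have := cnorm_sqrt_iterB (k + n); rewrite addSn; lra.
Qed.

(** The case of norm exactly 1 is included, where the iteration need not be a strict contraction.
    The Cauchy property comes from telescoping against the bounded increasing sequence [t]. *)
Lemma sqrt_iter_cvg : exists s : A, forall e, 0 < e ->
  exists N, forall n, (N <= n)%N -> cnorm (p n - s) < e.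
Proof.
have tsup : has_sup (range t).
  split; first by exists (t 0%N), 0%N.
  by exists 1 => _ [n _ <-]; have /andP[] := sqrt_bound_itv n.
have tle m n : (n <= m)%N -> t n <= t m.
  by move=> /cnorm_sqrt_iterB_le; have := cnorm_ge0 (p m - p n); lra.
have [|s ps] := @cnorm_complete _ A p.
  move=> e e0; have [_ [N _ <-] tN] := sup_adherent e0 tsup.
  have tm m : t m <= sup (range t) by apply: sup_upper_bound => //; exists m.
  suff h m n : (N <= n)%N -> (n <= m)%N -> cnorm (p m - p n) < e.
    exists N => m n Nm Nn; have [nm|/ltnW mn] := leqP n m; first exact: h.
    by rewrite -cnormN opprB; exact: h.
  move=> Nn nm; have := cnorm_sqrt_iterB_le nm; have := tle _ _ Nn; have := tm m.
  lra.
exists s => e e0; move/cvgrPdist_lt : ps => /(_ e e0)[N _ h].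
by exists N => n /h /=; rewrite sub0r normrN ger0_norm// cnorm_ge0.
Qed.

End iteration.

(** A substitute for functional calculus. The bound on [1 - y] allows the lemma to be applied again,
    to get a root of [y]; the commutation clause keeps iterated roots commuting with the original
    element. *)
Lemma cstar_sqrt w : star w = w -> cnorm w <= 1 ->
  exists y : A, [/\ star y = y, cnorm (1 - y) <= 1, y * y = 1 - w &
    forall a, a * w = w * a -> a * y = y * a].
Proof.
move=> ws w1; have [s sP] := sqrt_iter_cvg w1.
have p1 n : cnorm (sqrt_iter w n) <= 1.
  by apply: le_trans (cnorm_sqrt_iter w1 n) _; have /andP[] := sqrt_bound_itv n.
have lim e : 0 < e -> exists n, cnorm (sqrt_iter w n - s) <= e /\
    cnorm (sqrt_iter w n.+1 - s) <= e.
  move=> /sP[N h]; exists N; split; apply/ltW/h => //; exact: leqnSn.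
have s1 : cnorm s <= 1.
  apply/ler_addgt0Pr => e /lim[n [h _]].
  have := ler_cnormB (sqrt_iter w n) (sqrt_iter w n - s); rewrite opprB addrC subrK.
  have := p1 n; lra.
have ss : star s = s.
  apply/eqP; rewrite -subr_eq0; apply/eqP/(@cnorm_small _ 2) => e /lim[n [h _]].
  have -> : star s - s = (sqrt_iter w n - s) - star (sqrt_iter w n - s).
    by rewrite starB sqrt_iter_star// opprB [RHS]addrC addrA subrK.
  by apply: le_trans (ler_cnormB _ _) _; rewrite cnorm_star; lra.
(* The fixed point equation in the limit. Of the factor 4, two come from [q' - s] taken twice and
   two from the difference of squares of contractions. *)
have sw : w + s * s = s + s.
  apply/eqP; rewrite -subr_eq0; apply/eqP/(@cnorm_small _ 4) => e /lim[n [h h']].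
  set q := sqrt_iter w n in h *; set q' := sqrt_iter w n.+1 in h' *.
  have q'E : q' + q' = w + q * q.
    rewrite /q' /= -/q -scalerDl -rmorphD /= (_ : 2^-1 + 2^-1 = 1 :> R) ?scale1r//.
    by field.
  have -> : w + s * s - (s + s) = (q' - s) + (q' - s) - (q * q - s * s).
    rewrite addrACA q'E opprB -opprD; move: (q * q) (s * s) (s + s) => u u' u''.
    by rewrite addrACA [- u'' - u]addrC addrA (addrAC w u) addrK.
  have := cnorm_subr_sqr (p1 n) s1 h.
  have := ler_cnormB ((q' - s) + (q' - s)) (q * q - s * s).
  have := ler_cnormD (q' - s) (q' - s); lra.
exists (1 - s); split.
- by rewrite starB star1 ss.
- by rewrite opprB addrC subrK.
- rewrite mulrBl mul1r mulrBr mulr1 opprB.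
  have -> : s * s = (s + s) - w by rewrite -sw addrC addKr.
  by rewrite (addrAC (s + s)) addrK addrA subrK.
move=> a aw; rewrite mulrBr mulrBl mulr1 mul1r; congr (_ - _).
apply/eqP; rewrite -subr_eq0; apply/eqP/(@cnorm_small _ (2 * cnorm a)) => e /lim[n [h _]].
have -> : a * s - s * a = (sqrt_iter w n - s) * a - a * (sqrt_iter w n - s).
  by rewrite mulrBl mulrBr (sqrt_iter_comm _ aw) opprB [RHS]addrC addrA subrK.
apply: le_trans (ler_cnormB _ _) _.
have := ler_cnormM (sqrt_iter w n - s) a; have := ler_cnormM a (sqrt_iter w n - s).
have := cnorm_ge0 a; nra.
Qed.

Lemma cnorm_1subsqr x : star x = x -> cnorm x <= 1 -> cnorm (1 - x * x) <= 1.
Proof.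
move=> xs x1.
have xx1 : cnorm (x * x) <= 1.
  by rewrite -{1}xs cstar_identity expr_le1// cnorm_ge0.
have [|c [cs _ cc comm]] := cstar_sqrt _ xx1; first by rewrite starM xs.
have xc : x * c = c * x by apply: comm; rewrite mulrA.
rewrite -cc -{1}cs cstar_identity expr_le1 ?cnorm_ge0//.
pose u := x + 'i *: c.
have su : star u = x - 'i *: c by rewrite starD starZ xs cs conjCi scaleNr.
have u1 : cnorm u = 1.
  have uu : star u * u = 1.
    have ii : 'i * 'i = -1 :> C by rewrite -expr2 sqrCi.
    rewrite su /u mulrDr !mulrBl -!scalerAr -!scalerAl -xc scalerA ii.
    by rewrite scaleN1r opprK cc addrA subrK addrC subrK.
  have := @cstar_identity _ A u; rewrite uu cnorm1 => /esym/eqP.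
  by rewrite sqrf_eq1 => /orP[/eqP//|/eqP h]; have := cnorm_ge0 u; rewrite h; lra.
have : cnorm (u - star u) <= 2.
  by apply: le_trans (ler_cnormB _ _) _; rewrite cnorm_star u1; lra.
have -> : u - star u = (2 * 'i) *: c.
  by rewrite su opprB addrC addrA subrK -scalerDl mulr_natl mulr2n.
rewrite cnormZ rnormM (_ : rnorm (2 : C) = 2); last by rewrite /rnorm normr_nat.
rewrite (_ : rnorm ('i : C) = 1); last by rewrite /rnorm normCi.
lra.
Qed.

End square_root.

(** * Comparison of faithful representations *)

Section faithful_rep.
Variables (R : realType) (A : cstarAlgType R) (H : hilbertType R).
Variable rho : A -> H -> H.
Hypothesis hrho : is_faithful_rep rho.
Local Notation C := R[i].
Implicit Types (a b : A) (x y : H).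

Lemma ip_rep_sqr a x : ip (rho (star a * a) x) x = (rnorm (rho a x) ^+ 2)%:C.
Proof. by rewrite (repM hrho) ip_rep_star// inner_rnorm. Qed.

(** With y y = 1 - a* a, the vector [rho a x] loses exactly |rho y x|^2 against [rho 1 x]. *)
Lemma rep_contr_cnorm a x : cnorm a <= 1 -> rnorm (rho a x) <= rnorm x.
Proof.
move=> a1; have [||y [ys _ yy _]] := @cstar_sqrt _ _ (star a * a).
- by rewrite starM starK.
- by rewrite cstar_identity expr_le1// cnorm_ge0.
apply: le_trans (rep1_contr hrho x).
rewrite -(@ler_pXn2r _ 2) ?nnegrE ?rnorm_ge0//.
suff -> : rnorm (rho a x) ^+ 2 = rnorm (rho 1 x) ^+ 2 - rnorm (rho y x) ^+ 2.
  by rewrite lerBlDr lerDl sqr_ge0.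
apply: complexI; rewrite rmorphB /= -!ip_rep_sqr star1 mulr1 ys yy.
by rewrite repDl// repNl// innerDl innerNl opprB addrC subrK.
Qed.

Lemma ler_rep_cnorm a x : rnorm (rho a x) <= cnorm a * rnorm x.
Proof.
have [a0|a0] := eqVneq (cnorm a) 0.
  by rewrite (cnorm_eq0 _ a0) rep0l// rnorm0 mulr_ge0 ?cnorm_ge0 ?rnorm_ge0.
have ap : 0 < cnorm a by rewrite lt_neqAle eq_sym a0 cnorm_ge0.
have := @rep_contr_cnorm (((cnorm a)^-1)%:C *: a) x.
have k0 : 0 <= (cnorm a)^-1 by rewrite invr_ge0 cnorm_ge0.
rewrite cnorm_realZ// mulVf// lexx => /(_ isT).
rewrite repZl// rnormZ rnorm_real (ger0_norm k0).
by rewrite mulrC ler_pdivrMr// mulrC.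
Qed.

(* With x := star a * a - r the double square root m is the absolute value of x,
   and rho m = - rho x because both are positive with the same square. *)
Lemma rep_bound_sqrt a (r : R) : 0 <= r <= 2^-1 -> cnorm (star a * a) <= 2^-1 ->
  (forall x, rnorm (rho a x) ^+ 2 <= r * rnorm x ^+ 2) ->
  exists2 z : A, star z = z & z * z = r%:C *: 1 - star a * a.
Proof.
move=> /andP[r0 r1] a1 ar; set h := star a * a in a1 *.
have hs : star h = h by rewrite starM starK.
pose x := h - r%:C *: 1.
have xs : star x = x by rewrite starB hs star_realZ star1.
have x1 : cnorm x <= 1.
  apply: le_trans (ler_cnormB _ _) _; rewrite cnorm_realZ// cnorm1; lra.
have xE : x = h - r%:C *: 1 by [].
clearbody x.
have xx1 : cnorm (x * x) <= 1.
  by rewrite -{1}xs cstar_identity expr_le1// cnorm_ge0.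
have [|c [cs _ cc ccomm]] := cstar_sqrt _ xx1; first by rewrite starM xs.
have xc : x * c = c * x by apply: ccomm; rewrite mulrA.
have cc1 : cnorm (c * c) <= 1 by rewrite cc cnorm_1subsqr.
have [|m [ms m1 mm mcomm]] := cstar_sqrt _ cc1; first by rewrite starM cs.
have {mm} mm : m * m = x * x by rewrite mm cc opprB addrC subrK.
have xm : x * m = m * x by apply: mcomm; rewrite mulrA xc -mulrA xc mulrA.
have [|z [zs _ zz _]] := cstar_sqrt _ m1; first by rewrite starB star1 ms.
have {zz} zz : z * z = m by rewrite zz opprB addrC subrK.
exists z => //; rewrite zz -[RHS]opprB -xE; apply/eqP; rewrite -subr_eq0 opprK.
apply/eqP/(rep_inj hrho) => xi; rewrite rep0l//.
(* Since (m - x)(m + x) = 0, [m] and [x] agree on [eta]. Paired with [eta], the first gives |z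
   eta|^2 and the second |a eta|^2 - r |eta|^2 <= 0, so z eta = 0. Then m + x kills [eta], and [eta]
   is orthogonal to itself. *)
pose eta := rho (m + x) xi; rewrite -/eta.
have Ds : star (m + x) = m + x by rewrite starD ms xs.
have eta1 : rho 1 eta = eta by rewrite /eta -(repM hrho) mul1r.
have mxeta : rho m eta = rho x eta.
  apply/eqP; rewrite -subr_eq0 -repNl// -repDl// /eta -(repM hrho).
  by rewrite mulrDr !mulrBl mm xm addrA subrK subrr rep0l.
have xeta : ip (rho x eta) eta = (rnorm (rho a eta) ^+ 2 - r * rnorm eta ^+ 2)%:C.
  rewrite xE repDl// repNl// repZl// eta1 innerDl innerNl innerZl inner_rnorm.
  by rewrite ip_rep_sqr -rmorphM -rmorphB.
have meta : ip (rho m eta) eta = (rnorm (rho z eta) ^+ 2)%:C.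
  by rewrite -zz -{1}zs ip_rep_sqr.
have zeta : rho z eta = 0.
  apply: rnorm0_eq0; apply/eqP; rewrite -sqrf_eq0 eq_le sqr_ge0 andbT.
  move: meta; rewrite mxeta xeta => /complexI <-.
  by rewrite subr_le0.
have m0 : rho m eta = 0 by rewrite -zz (repM hrho) zeta rep0r.
apply: rnorm0_eq0; apply/eqP; rewrite -sqrf_eq0; apply/eqP/complexI.
rewrite -inner_rnorm {1}/eta -{1}Ds ip_rep_star// repDl// -mxeta m0 addr0.
exact: inner0r.
Qed.

End faithful_rep.

Section rep_comparison.
Variables (R : realType) (A : cstarAlgType R) (H1 H2 : hilbertType R).
Variables (rho1 : A -> H1 -> H1) (rho2 : A -> H2 -> H2).
Hypotheses (hrho1 : is_faithful_rep rho1) (hrho2 : is_faithful_rep rho2).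
Local Notation C := R[i].

(** The bound in [rho1] yields a self-adjoint z in [A] with z z = k^2 - b* b; applying [rho2] to
    this identity gives the bound there. *)
Lemma rep_contr (a : A) : (forall x, rnorm (rho1 a x) <= rnorm x) ->
  forall x, rnorm (rho2 a x) <= rnorm x.
Proof.
move=> a1 x; set N := cnorm (star a * a).
have N0 : 0 <= N by exact: cnorm_ge0.
(* Chosen so that both k^2 and k^2 N are at most 1/2, as [rep_bound_sqrt] requires. *)
pose k := (2 + N)^-1.
have k0 : 0 < k by rewrite invr_gt0 ltr_wpDr.
have kN : k * (2 + N) = 1 by rewrite mulVf// gt_eqF// ltr_wpDr.
pose b := k%:C *: a.
have bb : star b * b = (k ^+ 2)%:C *: (star a * a).
  by rewrite /b star_realZ -scalerAl -scalerAr scalerA rmorphXn.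
have [||y|z zs zz] := @rep_bound_sqrt _ _ _ _ hrho1 b (k ^+ 2).
- by rewrite sqr_ge0 /=; nra.
- by rewrite bb cnorm_realZ ?sqr_ge0// -/N; nra.
- rewrite repZl// rnormZ rnorm_real (ger0_norm (ltW k0)) exprMn.
  by rewrite ler_wpM2l ?sqr_ge0// ler_pXn2r ?nnegrE ?rnorm_ge0.
rewrite -(@ler_pXn2r _ 2) ?nnegrE ?rnorm_ge0//.
rewrite -(@ler_pM2l _ (k ^+ 2)) ?exprn_gt0//.
have -> : k ^+ 2 * rnorm (rho2 a x) ^+ 2 = rnorm (rho2 b x) ^+ 2.
  by rewrite repZl// rnormZ rnorm_real (ger0_norm (ltW k0)) exprMn.
have -> : rnorm (rho2 b x) ^+ 2 = k ^+ 2 * rnorm (rho2 1 x) ^+ 2 - rnorm (rho2 z x) ^+ 2.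
  apply: complexI; rewrite rmorphB (rmorphM _ (k ^+ 2)) /=.
  rewrite -!(ip_rep_sqr hrho2) star1 mulr1 zs zz.
  by rewrite repDl// repNl// repZl// innerDl innerNl innerZl opprB addrC subrK.
have : rnorm (rho2 1 x) ^+ 2 <= rnorm x ^+ 2.
  by rewrite ler_pXn2r ?nnegrE ?rnorm_ge0// rep1_contr.
have := sqr_ge0 (rnorm (rho2 z x)); have := sqr_ge0 k; nra.
Qed.

End rep_comparison.

Lemma sqr_growth_le1 (R : realType) (t : nat -> R) (M : R) :
  (forall n, 0 <= t n) -> (forall n, t n ^+ 2 <= t n.+1) -> (forall n, t n <= M) ->
  t 0%N <= 1.
Proof.
move=> t0 tS tM; rewrite leNgt; apply/negP => t1.
pose e := t 0%N - 1; have e0 : 0 < e by rewrite subr_gt0.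
(* Linear growth already contradicts the bound [M]: the square of 1 + k e is at least 1 + (k + 1) e
   for k >= 1. *)
have h n : 1 + n.+1%:R * e <= t n.
  elim: n => [|n ih]; first by rewrite mul1r addrC subrK.
  apply: le_trans (tS n).
  have n0 : 0 <= n.+1%:R :> R by [].
  have -> : n.+2%:R = n.+1%:R + 1 :> R by rewrite -natr1.
  have : 0 <= n.+1%:R * e by rewrite mulr_ge0// ltW.
  have : 1 <= n.+1%:R :> R by rewrite ler1n.
  move: (n.+1%:R) ih => k ih k1 ke; nra.
have [n nM] : exists n, M / e < n%:R.
  exists (Num.bound (M / e)); apply: archi_boundP.
  by rewrite divr_ge0 ?(ltW e0)// (le_trans (t0 0%N)).
have := h n; have := tM n; move: nM; rewrite ltr_pdivrMr// -natr1; nra.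
Qed.

(** * Matrices over [A] acting on finite direct sums of [H] *)

Section rep_matrix.
Variables (R : realType) (A : cstarAlgType R) (H : hilbertType R).
Variable rho : A -> H -> H.
Hypothesis hrho : is_faithful_rep rho.
Local Notation C := R[i].
Variable n : nat.
Implicit Types (b : 'M[A]_n) (x y : 'I_n -> H).

Definition star_mx b : 'M[A]_n := \matrix_(i, j) star (b j i).
Definition rep_mx b x : 'I_n -> H := fun i => \sum_j rho (b i j) (x j).
Definition ipn x y : C := \sum_i ip (x i) (y i).
Definition sqn x : R := \sum_i rnorm (x i) ^+ 2.

Lemma sqn_ge0 x : 0 <= sqn x.
Proof. by apply: sumr_ge0 => i _; exact: sqr_ge0. Qed.

Lemma ipn_sqn x : ipn x x = (sqn x)%:C.
Proof. by rewrite rmorph_sum; apply: eq_bigr => i _; rewrite inner_rnorm. Qed.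

Lemma star_mxK b : star_mx (star_mx b) = b.
Proof. by apply/matrixP => i j; rewrite !mxE starK. Qed.

Lemma rep_mxM b c x : rep_mx (b *m c) x = rep_mx b (rep_mx c x).
Proof.
apply/funext => i; rewrite /rep_mx.
under [RHS]eq_bigr do rewrite rep_sumr//.
rewrite exchange_big; apply: eq_bigr => k _; rewrite mxE.
rewrite (big_morph (fun a => rho a (x k)) (fun a1 a2 => repDl hrho a1 a2 _) (rep0l hrho _)).
by apply: eq_bigr => j _; rewrite (repM hrho).
Qed.

Lemma ipn_star b x y : ipn (rep_mx (star_mx b) x) y = ipn x (rep_mx b y).
Proof.
rewrite /ipn /rep_mx; under eq_bigr do rewrite inner_suml.
rewrite exchange_big; apply: eq_bigr => j _; rewrite inner_sumr.
by apply: eq_bigr => i _; rewrite mxE ip_rep_star.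
Qed.

(** Expansion of |x - t y|^2 >= 0: Cauchy--Schwarz with a free parameter and no square root. *)
Lemma two_Re_ipn (t : R) x y :
  2 * t * complex.Re (ipn x y) <= sqn x + t ^+ 2 * sqn y.
Proof.
rewrite /ipn /sqn mulr_sumr -big_split /=.
have -> : complex.Re (\sum_i ip (x i) (y i)) = \sum_i complex.Re (ip (x i) (y i)).
  have ReD : {morph @complex.Re R : u v / u + v >-> u + v} by case=> ? ? [].
  exact: (big_morph _ ReD).
rewrite mulr_sumr; apply: ler_sum => i _; rewrite -subr_ge0.
suff -> : rnorm (x i) ^+ 2 + t ^+ 2 * rnorm (y i) ^+ 2 - 2 * t * complex.Re (ip (x i) (y i)) =
    rnorm (x i - t%:C *: y i) ^+ 2 by exact: sqr_ge0.
have sq : (t ^+ 2)%:C = t%:C * t%:C :> C by rewrite -expr2 rmorphXn.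
have tt : Num.conj t%:C = t%:C :> C by rewrite conj_Creal// complex_real.
have re (z : C) : (2 * t * complex.Re z)%:C = t%:C * (z + Num.conj z).
  by rewrite addcJ !rmorphM /= rmorph_nat mulrCA mulrA.
apply: complexI; rewrite rmorphB rmorphD (rmorphM _ (t ^+ 2)) /= re sq -!inner_rnorm.
rewrite innerDl !innerDr !innerNl !innerNr !innerZl !innerZr tt -(inner_conj (x i)).
move: (t%:C) (ip (x i) (y i)) (ip (y i) (x i)) => u v v'.
by rewrite opprK mulrDr opprD mulrA addrACA [X in _ + X = _]addrC.
Qed.

Lemma mxbound_sqn b (c : R) : mxbound (fun i j => rho (b i j)) c <->
  forall x, sqn (rep_mx b x) <= c ^+ 2 * sqn x.
Proof. by []. Qed.

(** |b* x|^2 is the inner product of b b* x with x. With parameter 1, 2 |b* x|^2 <= |b b* x|^2 +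
    |x|^2 <= |b* x|^2 + |x|^2. *)
Lemma mxbound_star b : mxbound (fun i j => rho (b i j)) 1 ->
  mxbound (fun i j => rho (star_mx b i j)) 1.
Proof.
move=> /mxbound_sqn b1; apply/mxbound_sqn => x.
have := two_Re_ipn 1 (rep_mx b (rep_mx (star_mx b) x)) x.
rewrite -{1}(star_mxK b) ipn_star ipn_sqn /= mulr1 expr1n mul1r.
have := b1 (rep_mx (star_mx b) x); rewrite expr1n mul1r; lra.
Qed.

(** [two_Re_ipn] with parameter [t] equal to |b x|^2, which is itself the inner product of b* b x
    with x. *)
Lemma sqn_power b x : sqn x <= 1 ->
  sqn (rep_mx b x) ^+ 2 <= sqn (rep_mx (star_mx b *m b) x).
Proof.
move=> x1; set t := sqn (rep_mx b x).
have := two_Re_ipn t (rep_mx (star_mx b *m b) x) x.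
rewrite rep_mxM ipn_star ipn_sqn /= -/t -rep_mxM.
have := sqn_ge0 (rep_mx b x); rewrite -/t; have := sqn_ge0 x.
have := sqr_ge0 t; nra.
Qed.

Lemma mxbound_comp b : mxbound (fun i j => rho (b i j)) 1 ->
  mxbound (fun i j => rho ((star_mx b *m b) i j)) 1.
Proof.
move=> b1; have /mxbound_sqn bs1 := mxbound_star b1.
apply/mxbound_sqn => x; rewrite rep_mxM.
apply: le_trans (bs1 _) _; rewrite expr1n !mul1r.
by have := b1 x; rewrite expr1n mul1r.
Qed.

Lemma mxbound_entry b i j (x : H) : mxbound (fun i j => rho (b i j)) 1 ->
  rnorm (rho (b i j) x) <= rnorm x.
Proof.
move=> /(_ (fun l => if l == j then x else 0)) b1.
rewrite -(@ler_pXn2r _ 2) ?nnegrE ?rnorm_ge0//; move: b1; rewrite expr1n mul1r.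
rewrite [X in _ <= X -> _](bigD1 j)//= eqxx [X in _ <= _ + X -> _]big1 ?addr0; last first.
  by move=> l /negbTE ->; rewrite rnorm0 expr0n.
move=> h; apply: le_trans h; rewrite (bigD1 i)//= (bigD1 j)//= eqxx.
rewrite [X in _ <= rnorm (_ + X) ^+ 2 + _]big1 ?addr0; last first.
  by move=> l /negbTE ->; rewrite rep0r.
by rewrite lerDl; apply: sumr_ge0 => k _; exact: sqr_ge0.
Qed.

End rep_matrix.

Section rep_matrix_comparison.
Variables (R : realType) (A : cstarAlgType R) (H1 H2 : hilbertType R).
Variables (rho1 : A -> H1 -> H1) (rho2 : A -> H2 -> H2).
Hypotheses (hrho1 : is_faithful_rep rho1) (hrho2 : is_faithful_rep rho2).

(** All iterates [B k] are contractions for [rho1], hence so are their entries, and [rep_contr]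
    carries the entries to [rho2]. This crude bound depends on [n] but not on [k], whereas |B k x|^2
    is at least squared at each step; so it starts at most 1. No norm on matrices over [A] is
    involved. *)
Lemma rep_mxbound n (b : 'M[A]_n) : mxbound (fun i j => rho1 (b i j)) 1 ->
  mxbound (fun i j => rho2 (b i j)) 1.
Proof.
move=> b1; apply: mxboundP => // [*|x x1]; first exact: repZr.
rewrite expr1n.
pose B := fix B k := if k is k'.+1 then star_mx (B k') *m B k' else b.
have B1 k : mxbound (fun i j => rho1 (B k i j)) 1.
  by elim: k => [//|k ih]; exact: mxbound_comp.
have xl l : rnorm (x l) <= 1.
  rewrite -(@expr_le1 _ 2) ?rnorm_ge0//; apply: le_trans x1.
  by rewrite (bigD1 l)//= lerDl; apply: sumr_ge0 => k _; exact: sqr_ge0.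
apply: (@sqr_growth_le1 _ (fun k => sqn (rep_mx rho2 (B k) x))
    (\sum_(i < n) (n%:R) ^+ 2)) => k.
- exact: sqn_ge0.
- exact: sqn_power.
apply: ler_sum => i _; rewrite ler_pXn2r ?nnegrE ?rnorm_ge0//.
apply: le_trans (rnorm_sum _ _ _) _.
apply: (@le_trans _ _ (\sum_(j < n) 1)); last by rewrite sumr_const card_ord.
apply: ler_sum => j _; apply: le_trans (xl j); apply: (rep_contr hrho1) => //.
by move=> y; exact: mxbound_entry.
Qed.

End rep_matrix_comparison.

(** * Nets and the equivalence *)

Section unit_component.
Variables (R : realType) (A : cstarAlgType R) (H : hilbertType R).
Variables (rho : A -> H -> H) (G : groupType) (alpha : G -> {lrmorphism A -> A}).
Hypotheses (hrho : is_faithful_rep rho) (halpha : is_action alpha).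

(** Comparing [rho] with this representation by [rep_mxbound] says that alpha_t is completely
    contractive. *)
Lemma faithful_rep_action (t : G) : is_faithful_rep (fun a => rho (alpha t a)).
Proof.
split.
- by move=> a; exact: rep_linear.
- by move=> a; exact: rep_bounded.
- by move=> c a b x; rewrite linearP (repDZ hrho).
- by move=> a b x; rewrite rmorphM (repM hrho).
- by move=> a x y; rewrite (action_star halpha) (rep_star hrho).
- by move=> a b ab; apply: (bij_inj (action_bij halpha t)); exact: (rep_inj hrho).
Qed.

(** A matrix placed at the unit of [G] acts block diagonally, with block rho(alpha_{g^-1}(a)) at
    [g]. The blocks are contractions by [rep_mxbound], and the image under the multiplier is read
    off at the block of the unit. *)
Lemma cbnormA_unit (F : G -> {linear A -> A}) (c : R) : 0 <= c ->
  (hs_norm rho alpha F <= c%:E)%E -> (cbnormA rho (F 1%g) <= c%:E)%E.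
Proof.
move=> c0 /(hs_norm_le hrho halpha) Fc; apply/cb_norm_leP => n a _.
move=> /(rep_mxnormP hrho _ ler01) a1.
have := Fc n (fun i j => single 1%g (a i j)) (fun i j => l1_single _ _).
have -> : (l2_mxnorm (\matrix_(i, j) integrated_form rho alpha
    (single 1%g (a i j))) <= 1)%E.
  apply/l2_mxnorm_leP => // xi xi1.
  (* With [s] constant all translations are trivial, and [fell] reduces to a bound valid block by
     block. *)
  have := fell (s := fun=> 1%g) (T := fun g k l => rho (alpha g^-1%g (a k l)))
    (fun h => rep_mxbound hrho (faithful_rep_action _) a1) xi1.
  rewrite mulr1; apply: le_trans; rewrite le_eqVlt; apply/orP; left; apply/eqP.
  apply: eq_bigr => k _; congr sql2; apply/funext => g; rewrite fct_sumE.
  apply: eq_bigr => l _; rewrite mxE (integrated_form_single alpha hrho).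
  by rewrite mulgV.
move=> /(_ isT)/(l2_mxnorm_leP _ c0) h.
apply/rep_mxnormP => //; apply: mxboundP => // [*|x x1]; first exact: repZr.
pose xi l (g : G) := if g == 1%g then x l else 0.
have xi1 : (\sum_l sql2 (xi l) <= 1)%E.
  under eq_bigr => l _.
    rewrite (sql2_fsupp (s := [:: 1%g]))//; last first.
      by move=> g; rewrite inE /xi => /negbTE ->.
    rewrite big_seq1 /xi eqxx; over.
  by rewrite sumEFin lee_fin.
rewrite -lee_fin; apply: le_trans (h xi xi1).
apply: le_trans (sum_sql2_ge _ (s := [:: 1%g]) isT).
rewrite lee_fin le_eqVlt; apply/orP; left; apply/eqP; apply: eq_bigr => k _.
rewrite big_seq1 fct_sumE; congr (rnorm _ ^+ 2); apply: eq_bigr => l _.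
rewrite !mxE mult_by_single (integrated_form_single alpha hrho).
by rewrite /translation invg1 mul1g /xi eqxx (alpha1 halpha).
Qed.

Lemma cbnormA_scale (phi psi : A -> A) (z : R[i]) (d : R) : 0 <= d ->
  (forall a, psi a = z *: phi a) ->
  (cbnormA rho phi <= d%:E)%E -> (cbnormA rho psi <= (rnorm z * d)%:E)%E.
Proof.
move=> d0 psiE /cb_norm_leP h; apply/cb_norm_leP => n a Da a1.
have zd : 0 <= rnorm z * d by rewrite mulr_ge0 ?rnorm_ge0.
have /(rep_mxnormP hrho _ d0) b := h n a Da a1.
apply/(rep_mxnormP hrho _ zd) => x.
rewrite exprMn -mulrA.
apply: (@le_trans _ _ (rnorm z ^+ 2 *
    \sum_k rnorm (\sum_l rho (map_mx phi a k l) (x l)) ^+ 2)).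
  rewrite mulr_sumr le_eqVlt; apply/orP; left; apply/eqP.
  apply: eq_bigr => k _; rewrite -exprMn -rnormZ scaler_sumr.
  congr (rnorm _ ^+ 2); apply: eq_bigr => l _.
  by rewrite !mxE psiE repZl.
by rewrite ler_wpM2l ?sqr_ge0//; exact: b.
Qed.

(** Invariance under [rho 1] gives (rho 1 x0, x0) = 1, the value to which v(t) must converge. *)
Lemma rep_unit_vector : exists2 x0 : H, rnorm x0 = 1 & rho 1 x0 = x0.
Proof.
have [x x0] : exists x, rho 1 x != 0.
  apply: contrapT => /forallNP h.
  have : 1 = 0 :> A.
    apply: (rep_inj hrho) => x; rewrite rep0l//.
    by have /negP := h x; rewrite negbK => /eqP.
  by apply/eqP; exact: oner_neq0.
have nx : rnorm (rho 1 x) != 0 by apply: contra x0 => /eqP/rnorm0_eq0 ->.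
exists (((rnorm (rho 1 x))^-1)%:C *: rho 1 x).
  by rewrite rnormZ rnorm_real ger0_norm ?invr_ge0 ?rnorm_ge0// mulVf.
by rewrite repZr// -(repM hrho) mul1r.
Qed.

End unit_component.

Section nets.
Variable R : realType.

Lemma tails_filter (I : Type) (le : I -> I -> Prop) : directed le ->
  ProperFilter (tails le).
Proof.
move=> [[i0] refl trans ub]; split.
  by move=> [i h]; exact: (h i (refl i)).
split.
- by exists i0.
- move=> P Q [i Pi] [j Qj]; have [k ik jk] := ub i j.
  by exists k => l kl; split; [apply: Pi|apply: Qj]; exact: trans kl.
- by move=> P Q PQ [i Pi]; exists i => j /Pi/PQ.
Qed.

Lemma net_cvg0P (I : Type) (le : I -> I -> Prop) (x : I -> R) : directed le ->
  (x @ tails le --> (0 : R)) <->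
  (forall e, 0 < e -> exists i0, forall i, le i0 i -> `|x i| < e).
Proof.
move=> dle; have F := tails_filter dle; split=> [/cvgrPdist_lt h e /h[i0 hi]|h].
  by exists i0 => i /hi /=; rewrite sub0r normrN.
apply/cvgrPdist_lt => e /h[i0 hi]; exists i0 => i /hi /=.
by rewrite sub0r normrN.
Qed.

Lemma directed_prod (I J : Type) (leI : I -> I -> Prop) (leJ : J -> J -> Prop) :
  directed leI -> directed leJ ->
  directed (fun p q : I * J => leI p.1 q.1 /\ leJ p.2 q.2).
Proof.
move=> [[i0] rI tI uI] [[j0] rJ tJ uJ]; split.
- by split; exact: (i0, j0).
- by move=> p; split.
- move=> p q r [pq1 pq2] [qr1 qr2].
  by split; [exact: tI qr1|exact: tJ qr2].
- move=> p q; have [k1 ? ?] := uI p.1 q.1; have [k2 ? ?] := uJ p.2 q.2.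
  by exists (k1, k2).
Qed.

(** The constant is taken positive because the multiplier bounds divide by it. *)
Lemma ereal_sup_ltyP (I : Type) (f : I -> \bar R) :
  (ereal_sup [set f i | i in [set: I]] < +oo)%E <->
  exists2 c : R, 0 < c & forall i, (f i <= c%:E)%E.
Proof.
split=> [h|[c c0 h]]; last first.
  apply: (@le_lt_trans _ _ c%:E); last exact: ltry.
  by apply: ge_ereal_sup => _ [i _ <-].
have ub i : (f i <= ereal_sup [set f i | i in [set: I]])%E.
  by apply: ereal_sup_ubound; exists i.
case: (ereal_sup _) h ub => [r _ ub|//|_ ub].
  exists (`|r| + 1) => [|i]; first by rewrite ltr_wpDl.
  apply: le_trans (ub i) _; rewrite lee_fin.
  by apply: le_trans (ler_norm r) _; rewrite lerDl.
by exists 1 => // i; apply: le_trans (ub i) _; rewrite leNye.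
Qed.

Lemma finite_set_uniq_seq (T : choiceType) (P : set T) : finite_set P ->
  exists s : seq T, uniq s /\ forall t, t \notin s -> ~ P t.
Proof.
move=> /finite_seqP[s Ps]; exists (undup s); split; first exact: undup_uniq.
by move=> t; rewrite mem_undup => ts; rewrite Ps /= => st; rewrite st in ts.
Qed.

End nets.

(** * The two implications *)

Section main.
Variables (R : realType) (A : cstarAlgType R) (H : hilbertType R).
Variables (rho : A -> H -> H) (G : groupType) (alpha : G -> {lrmorphism A -> A}).
Hypotheses (hrho : is_faithful_rep rho) (halpha : is_action alpha).

Lemma weakly_amenable_system (J : Type) (leJ : J -> J -> Prop)
    (phi : J -> {linear A -> A}) :
  weakly_amenable_group R G -> cbap_net rho leJ phi ->
  (forall i t a, phi i (alpha t a) = alpha t (phi i a)) ->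
  exists (I : Type) (le : I -> I -> Prop) (F : I -> G -> {linear A -> A}),
    weakly_amenable_net rho alpha le F /\
    forall i r t a, F i t (alpha r a) = alpha r (F i t a).
Proof.
move=> [I [le [v [dI vhs v1 /ereal_sup_ltyP[c c0 vc]]]]] [dJ phic phi1].
move=> /ereal_sup_ltyP[d d0 phid] phia.
pose F (p : I * J) (t : G) : {linear A -> A} := v p.1 t \*: phi p.2.
have FE p t a : F p t a = v p.1 t *: phi p.2 a by [].
clearbody F.
have Fc p : (hs_norm rho alpha (F p) <= (c * d)%:E)%E.
  have [_ /finite_set_uniq_seq[S [uS vS]]] := vhs p.1.
  apply: (@hs_norm_scale _ _ _ _ _ _ hrho halpha (v p.1) S (phi p.2)) => //.
  - by move=> t /vS /negP; rewrite negbK => /eqP.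
  - exact: ltW.
  - by apply: schur_bound_herz_schur => //; exact: ltW.
exists (I * J)%type, (fun p q => le p.1 q.1 /\ leJ p.2 q.2), F; split; last first.
  by move=> p r t a; rewrite !FE phia linearZ.
have dIJ := directed_prod dI dJ; split => //.
- move=> p; have [_ /[dup] vfin /finite_set_uniq_seq[S [uS vS]]] := vhs p.1.
  have Fcb t : (cbnormA rho (F p t) <= (rnorm (v p.1 t) * d)%:E)%E.
    by apply: (@cbnormA_scale _ _ _ _ hrho (phi p.2)) => //; exact: ltW.
  split; last first.
    apply: sub_finite_set vfin => t [a] /=; apply: contra_neq => vt.
    by rewrite FE vt scale0r.
  split; last exact: le_lt_trans (Fc p) (ltry _).
    by move=> t; exact: le_lt_trans (Fcb t) (ltry _).
  (* The sum over the support dominates each term, and the extra 1 keeps it positive even if [S] is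
     empty. *)
  apply/ereal_sup_ltyP; exists (\sum_(s <- S) rnorm (v p.1 s) * d + 1).
    by rewrite ltr_wpDl// sumr_ge0// => s _; rewrite mulr_ge0 ?rnorm_ge0 ?ltW.
  move=> t; apply: le_trans (Fcb t) _; rewrite lee_fin.
  apply: (@le_trans _ _ (\sum_(s <- S) rnorm (v p.1 s) * d)); last by rewrite lerDl.
  have nn s : 0 <= rnorm (v p.1 s) * d by rewrite mulr_ge0 ?rnorm_ge0 ?ltW.
  have [tS|/vS] := boolP (t \in S).
    by rewrite (big_rem t)//= lerDl sumr_ge0.
  by move=> /negP; rewrite negbK => /eqP ->; rewrite rnorm0 mul0r sumr_ge0.
- move=> p t; have [[n [b hb]] _] := phic p.2; exists n, b => a.
  have [z phiE] := hb a; exists (fun i => v p.1 t * z i).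
  rewrite FE phiE scaler_sumr; apply: eq_bigr => i _; exact: scalerA.
- move=> t a; apply/net_cvg0P => // e e0.
  have K0 : 0 < cnorm a + 1 by rewrite ltr_wpDl ?cnorm_ge0.
  (* The error splits as (v - 1) phi(a) + (phi(a) - a). The bound 1 in the minimum below gives
     |phi(a)| <= |a| + 1, which this choice compensates. *)
  have /(net_cvg0P _ dI)/(_ (e / 2 / (cnorm a + 1)))[|i0 hi] := v1 t.
    by rewrite !divr_gt0.
  have /(net_cvg0P _ dJ)/(_ (Num.min (e / 2) 1))[|j0 hj] := phi1 a.
    by rewrite lt_min ltr01 divr_gt0.
  exists (i0, j0) => -[i j] [/hi{}hi /hj{}hj] /=.
  rewrite ger0_norm ?cnorm_ge0// FE /=.
  move: hi hj; rewrite !ger0_norm ?rnorm_ge0 ?cnorm_ge0// lt_min => hi /andP[hj1 hj2].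
  have -> : v i t *: phi j a - a = (v i t - 1) *: phi j a + (phi j a - a).
    by rewrite scalerBl scale1r addrA subrK.
  apply: le_lt_trans (ler_cnormD _ _) _; rewrite cnormZ.
  have phia1 : cnorm (phi j a) <= cnorm a + 1.
    by have := ler_cnormD (phi j a - a) a; rewrite subrK; lra.
  have : rnorm (v i t - 1) * cnorm (phi j a) <= e / 2.
    apply: (@le_trans _ _ (e / 2 / (cnorm a + 1) * (cnorm a + 1))).
      by apply: ler_pM; rewrite ?rnorm_ge0 ?cnorm_ge0// ltW.
    by rewrite divfK// gt_eqF.
  lra.
- by apply/ereal_sup_ltyP; exists (c * d) => //; rewrite mulr_gt0.
Qed.

Lemma weakly_amenable_components (I : Type) (le : I -> I -> Prop)
    (F : I -> G -> {linear A -> A}) :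
  weakly_amenable_net rho alpha le F ->
  (forall i r t a, F i t (alpha r a) = alpha r (F i t a)) ->
  weakly_amenable_group R G /\ cbap_net rho le (fun i => F i 1%g).
Proof.
move=> [dI Fhs Ffr F1 /ereal_sup_ltyP[c c0 Fc]] Fa; split; last first.
  split => //.
  - by move=> i; split => //; have [[+ _ _] _] := Fhs i; apply.
  - apply/ereal_sup_ltyP; exists c => // i.
    by apply: (cbnormA_unit hrho halpha); [exact: ltW|exact: Fc].
have [x0 x01 rx0] := rep_unit_vector hrho.
pose v i t := ip (rho (F i t 1) x0) x0.
have vc i : herz_schur (v i) /\ (herz_schur_norm (v i) <= c%:E)%E.
  have [_ /finite_set_uniq_seq[S [uS vS]]] := Fhs i.
  apply: (@herz_schur_schur_bound _ _ _ S) => //.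
    move=> t /vS Ft; rewrite /v; suff -> : F i t 1 = 0 by rewrite rep0l// inner0l.
    by apply: contrapT => /eqP h; apply: Ft; exists 1.
  by apply: (hs_norm_schur_bound hrho halpha) => //; exact: ltW.
exists I, le, v; split => //.
- move=> i; split; first by have [] := vc i.
  have [_ Ffin] := Fhs i; apply: sub_finite_set Ffin => t /= vt.
  exists 1; apply: contra_neq vt => Ft.
  by rewrite /v Ft rep0l// inner0l.
- move=> t; apply/net_cvg0P => // e e0.
  have /(net_cvg0P _ dI)/(_ e e0)[i0 hi] := F1 t 1.
  exists i0 => i /hi; rewrite !ger0_norm ?rnorm_ge0 ?cnorm_ge0//.
  apply: le_lt_trans.
  (* Convergence of [v] is point-norm convergence of F_i(t) at the single element 1 of [A]. *)
  have -> : v i t - 1 = ip (rho (F i t 1 - 1) x0) x0.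
    by rewrite repDl// repNl// rx0 innerDl innerNl inner_rnorm x01 expr1n.
  apply: le_trans (rnorm_inner_le _ x01) _.
  by apply: le_trans (ler_rep_cnorm hrho _ _) _; rewrite x01 mulr1.
- by apply/ereal_sup_ltyP; exists c => // i; have [] := vc i.
Qed.

End main.

Theorem proposition4p8 (R : realType) (A : cstarAlgType R) (G : groupType)
    (alpha : G -> {lrmorphism A -> A}) (H : hilbertType R) (rho : A -> H -> H)
    (hA : separable_cstar A) (hG : countable [set: G]) (halpha : is_action alpha)
    (hH : exists2 D : set H, countable D & dense D)
    (hrho : is_faithful_rep rho) :
  (weakly_amenable_group R G /\
   exists (I : Type) (le : I -> I -> Prop) (phi : I -> {linear A -> A}),
     cbap_net rho le phi /\
     forall i t a, phi i (alpha t a) = alpha t (phi i a)) <->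
  (exists (I : Type) (le : I -> I -> Prop) (F : I -> G -> {linear A -> A}),
     weakly_amenable_net rho alpha le F /\
     forall i r t a, F i t (alpha r a) = alpha r (F i t a)).
Proof.
split=> [[wG [I [le [phi [cb phia]]]]]|[I [le [F [wF Fa]]]]].
  exact: weakly_amenable_system wG cb phia.
have [wG cb] := weakly_amenable_components hrho halpha wF Fa.
by split=> //; exists I, le, (fun i => F i 1%g).
Qed.
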